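(* Let $(R,\mathfrak m)$ be a Noetherian local ring and $M$ a finite $R$-module of dimension $d>0$. Let $\mathbf x=x_1,\ldots,x_r$ ($0\le r\le d$) be an amenable partial system of parameters of $M$ that is a $d$-sequence relative to $M$, and let $I=(\mathbf x)$. Then the $\mathbf j$-function of $M$ relative to $I$ is $$\psi^M_I(n)=\sum_{i=0}^r k_i(\mathbf x;M)\binom{n+r-i}{r-i}$$ for all $n\ge0$. Therefore $(-1)^i\,\mathrm j_i(\mathbf x;M)=k_i(\mathbf x;M)$ for all $0\le i\le r$.
   Context: ''Finite'' module means finitely generated; $\lambda(-)$ is length. A partial system of parameters of $M$ is a sequence $x_1,\ldots,x_r\in\mathfrak m$ with $\dim M=r+\dim M/(x_1,\ldots,x_r)M$; it is amenable to $M$ if the Koszul homology $\mathrm H_i(\mathbf x;M)$ has finite length for all $i>0$. A sequence $x_1,\ldots,x_n$ is a $d$-sequence relative to $M$ if $(x_1,\ldots,x_{i-1})M:_M x_ix_j=(x_1,\ldots,x_{i-1})M:_M x_j$ for all $1\le i\le j\le n$. With $\operatorname{gr}_I(M)=\bigoplus_{n\ge0}I^nM/I^{n+1}M$ and $\mathrm H^0_{\mathfrak m}(\operatorname{gr}_I(M))=\bigoplus_{k\ge0}\mathrm H_k$, where $\mathrm H_k=\mathrm H^0_{\mathfrak m}(I^kM/I^{k+1}M)$, the $\mathbf j$-function is $\psi^M_I(n)=\sum_{k\le n}\lambda(\mathrm H_k)$; for $n\gg0$ it agrees with a polynomial written $\sum_{i=0}^r(-1)^i\mathrm j_i(\mathbf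 x;M)\binom{n+r-i}{r-i}$, which defines the $\mathbf j$-coefficients $\mathrm j_i(\mathbf x;M)$. For an $R$-module $C$, $h^i(C)=\lambda(\mathrm H^i_{\mathfrak m}(C))$. Put $I_i=(x_1,\ldots,x_i)$ for $0\le i\le r$ and $$k_i(\mathbf x;M)=h^0\bigl(M/[(I_{r-i-1}M:_M x_{r-i})+x_{r-i}M]\bigr)\ \ (0\le i\le r-1),\qquad k_r(\mathbf x;M)=h^0(M).$$ *)

(* Defs.v *)
From HB Require Import structures.
From mathcomp Require Import all_boot all_order all_algebra.
From mathcomp Require Import boolp classical_sets.

Set Implicit Arguments.
Unset Strict Implicit.
Unset Printing Implicit Defensive.

Import Order.TTheory GRing.Theory Num.Theory.

Local Open Scope classical_set_scope.
Local Open Scope ring_scope.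

(* Throughout, a module of the form N / L with L <= N <= M is given by the    *)
(* pair of submodules L, N of M: submodules of N / L are submodules of M      *)
(* between L and N. Ideals of R are submodules of R^o.                        *)

(** Submodules and ideals *)

Definition submodule (R : comNzRingType) (M : lmodType R) (N : set M) : Prop :=
  submod_closed (mem N).

Definition span (R : comNzRingType) (M : lmodType R) (A : set M) : set M :=
  smallest (@submodule R M) A.

Definition finitely_generated (R : comNzRingType) (M : lmodType R)
    (N : set M) : Prop :=
  exists s : seq M, N = span [set` s].

Definition ideal (R : comNzRingType) (J : set R) : Prop :=
  @submodule R R^o J.

Definition ideal_span (R : comNzRingType) (A : set R) : set R :=
  @span R R^o A.

Definition noetherian (R : comNzRingType) : Prop :=
  forall J : set R, ideal J -> @finitely_generated R R^o J.

(* The library's [idealr_closed] includes properness. *)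
Definition prime_ideal (R : comNzRingType) (P : set R) : Prop :=
  idealr_closed (mem P) /\ prime_idealr_closed (mem P).

Definition maximal_ideal (R : comNzRingType) (J : set R) : Prop :=
  idealr_closed (mem J) /\
  forall K : set R, idealr_closed (mem K) -> J `<=` K -> K = J.

Definition local_ring (R : comNzRingType) (m : set R) : Prop :=
  maximal_ideal m /\ forall n : set R, maximal_ideal n -> n = m.

Definition msum (R : comNzRingType) (M : lmodType R) (L N : set M) : set M :=
  span (L `|` N).

Definition mscale (R : comNzRingType) (M : lmodType R)
    (J : set R) (N : set M) : set M :=
  span [set a *: v | a in J & v in N].

Definition ideal_pow (R : comNzRingType) (J : set R) (k : nat) : set R :=
  iter k (@mscale R R^o J) setT.

Definition colon (R : comNzRingType) (M : lmodType R)
    (L : set M) (a : R) : set M :=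
  [set v | L (a *: v)].

(** Dimension of M / L *)

Definition annihilator (R : comNzRingType) (M : lmodType R)
    (L : set M) : set R :=
  [set a | forall v, L (a *: v)].

Definition prime_chain (R : comNzRingType) (J : set R) : set nat :=
  [set n | exists P : nat -> set R,
    [/\ forall i, (i <= n)%N -> prime_ideal (P i),
        J `<=` P 0%N &
        forall i, (i < n)%N -> P i `<` P i.+1]].

(* A relation rather than a function: it holds for no [d] when M / L = 0 or   *)
(* when the dimension is infinite.                                            *)
Definition module_dim (R : comNzRingType) (M : lmodType R)
    (L : set M) (d : nat) : Prop :=
  prime_chain (annihilator L) d /\ ubound (prime_chain (annihilator L)) d.

(** Length of N / L *)

Definition submodule_chain (R : comNzRingType) (M : lmodType R)
    (L N : set M) : set nat :=
  [set n | exists c : nat -> set M,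
    [/\ forall i, (i <= n)%N -> submodule (c i),
        L `<=` c 0%N,
        c n `<=` N &
        forall i, (i < n)%N -> c i `<` c i.+1]].

Definition finite_length (R : comNzRingType) (M : lmodType R)
    (L N : set M) : Prop :=
  has_ubound (submodule_chain L N).

(* The value is 0 when N / L has infinite length. *)
Definition length (R : comNzRingType) (M : lmodType R) (L N : set M) : nat :=
  supremum 0%N (submodule_chain L N).

(** Zeroth local cohomology *)

(* H^0_m(N / L), the submodule of elements of N / L killed by a power of m,   *)
(* is [torsion m L N] / L.                                                    *)
Definition torsion (R : comNzRingType) (M : lmodType R)
    (m : set R) (L N : set M) : set M :=
  [set v | N v /\ exists k, forall a, ideal_pow m k a -> L (a *: v)].

(* h^0(M / L) *)
Definition h0 (R : comNzRingType) (M : lmodType R)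
    (m : set R) (L : set M) : nat :=
  length L (torsion m L setT).

(** The Koszul complex *)

(* An element of K(x; M) is f = \sum_S e_S (x) f S, S ranging over the        *)
(* subsets of the index set; e_S has degree #|S|, and                         *)
(*   d e_T = \sum_(j in T) (-1)^#|{k in T | k < j}| x_j e_(T - j).            *)
Definition koszul_diff (R : comNzRingType) (M : lmodType R) (r : nat)
    (x : 'I_r -> R) (f : {ffun {set 'I_r} -> M}) : {ffun {set 'I_r} -> M} :=
  [ffun S : {set 'I_r} => \sum_(j | j \notin S)
     ((-1) ^+ #|[pred k in S | (k < j)%N]| * x j) *: f (j |: S)%SET].

Definition koszul_deg (R : comNzRingType) (M : lmodType R) (r i : nat) :
    set {ffun {set 'I_r} -> M} :=
  [set f | forall S : {set 'I_r}, #|S| != i -> f S = 0].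
Arguments koszul_deg {R} M r i _.

Definition koszul_cycle (R : comNzRingType) (M : lmodType R) (r : nat)
    (x : 'I_r -> R) (i : nat) : set {ffun {set 'I_r} -> M} :=
  [set f | koszul_deg M r i f /\ koszul_diff x f = 0].
Arguments koszul_cycle {R} M {r} x i _.

Definition koszul_boundary (R : comNzRingType) (M : lmodType R) (r : nat)
    (x : 'I_r -> R) (i : nat) : set {ffun {set 'I_r} -> M} :=
  koszul_diff x @` koszul_deg M r i.+1.
Arguments koszul_boundary {R} M {r} x i _.

(** Partial systems of parameters, amenability, d-sequences *)

(* The sequence x_1, ..., x_r is indexed from 0, so that the ideal            *)
(* I_i = (x_1, ..., x_i) is generated by the x k with k < i.                  *)
Definition seq_ideal (R : comNzRingType) (r : nat) (x : 'I_r -> R)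
    (i : nat) : set R :=
  ideal_span [set x k | k in [set k : 'I_r | (k < i)%N]].

Definition seq_submod (R : comNzRingType) (M : lmodType R) (r : nat)
    (x : 'I_r -> R) (i : nat) : set M :=
  mscale (seq_ideal x i) setT.
Arguments seq_submod {R} M {r} x i _.

Definition partial_sop (R : comNzRingType) (M : lmodType R) (m : set R)
    (r : nat) (x : 'I_r -> R) : Prop :=
  (forall i, m (x i)) /\
  exists2 e : nat, module_dim (seq_submod M x r) e &
                   module_dim [set 0 : M] (r + e).

Definition amenable (R : comNzRingType) (M : lmodType R)
    (r : nat) (x : 'I_r -> R) : Prop :=
  forall i, (0 < i)%N ->
    finite_length (koszul_boundary M x i) (koszul_cycle M x i).

Definition d_sequence (R : comNzRingType) (M : lmodType R)
    (r : nat) (x : 'I_r -> R) : Prop :=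
  forall i j : 'I_r, (i <= j)%N ->
    colon (seq_submod M x i) (x i * x j) = colon (seq_submod M x i) (x j).

(** The j-function and its coefficients *)

Definition pow_submod (R : comNzRingType) (M : lmodType R)
    (J : set R) (k : nat) : set M :=
  mscale (ideal_pow J k) setT.
Arguments pow_submod {R} M J k _.

Definition j_function (R : comNzRingType) (M : lmodType R)
    (m I : set R) (n : nat) : nat :=
  (\sum_(k < n.+1)
    length (pow_submod M I k.+1)
           (torsion m (pow_submod M I k.+1) (pow_submod M I k)))%N.

Definition j_poly (r : nat) (c : {ffun 'I_r.+1 -> int}) (n : nat) : int :=
  \sum_(i < r.+1) (-1) ^+ i * c i * ('C(n + r - i, r - i))%:Z.

(* The j_i(x; M), 0 <= i <= r; the value is 0 if the j-function is not        *)
(* eventually of the form [j_poly c].                                         *)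
Definition j_coef (R : comNzRingType) (M : lmodType R) (m : set R)
    (r : nat) (x : 'I_r -> R) : {ffun 'I_r.+1 -> int} :=
  xget 0 [set c | exists n0 : nat, forall n : nat, (n0 <= n)%N ->
    (j_function M m (seq_ideal x r) n)%:Z = j_poly c n].

(* For i < r, [j = rev_ord i'] is the (0-based) index of x_(r-i), so that     *)
(* I_(r-i-1) is [seq_ideal x j].                                              *)
Definition k_coef (R : comNzRingType) (M : lmodType R) (m : set R)
    (r : nat) (x : 'I_r -> R) (i : 'I_r.+1) : nat :=
  if unlift ord_max i is Some i' then
    let j := rev_ord i' in
    h0 m (msum (colon (seq_submod M x j) (x j))
               (mscale (ideal_span [set x j]) setT))
  else h0 m [set 0 : M].

(* Main.v *)
Require Import Defs.
From mathcomp Require Import all_boot all_order all_algebra.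
From mathcomp Require Import boolp classical_sets.

Set Implicit Arguments.
Unset Strict Implicit.
Unset Printing Implicit Defensive.

Import Order.TTheory GRing.Theory Num.Theory.

Local Open Scope classical_set_scope.
Local Open Scope ring_scope.

(** Write I_s = (x_0, ..., x_(s-1)), I = I_r and U_s = I_s M : x_s. All the
    modules M / I_s M are treated at once: let G_s(n) be the degree n part of
    gr_I(M / I_s M), and u_s = h^0(M / I_s M).

    A d-sequence satisfies U_s /\ I M = I_s M ([colon_dseq_cap]) and
    I_s M /\ I^(n+1) M = I_s I^n M ([seqmul_cap_pow]). So multiplication by x_s
    from G_s(n) to G_s(n+1) has cokernel G_(s+1)(n+1); it is injective for
    n > 0, and for n = 0 its kernel is the image of U_s, which is isomorphic
    to U_s / I_s M.

    Amenability makes U_s / I_s M torsion ([amenable_colon_pow]): for a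
    d-sequence, x_s kills the homology in positive degree of the Koszul complex
    of x_0, ..., x_(s-1), so each v in U_i can be completed to a cycle of
    degree r - i of the whole Koszul complex with v as coefficient of
    e_i ... e_(r-1). In a boundary this coefficient lies in I_i M, so the power
    of m which kills the Koszul homology also kills U_i / I_i M. As x_s is in m,
    U_s / I_s M is then exactly the torsion of M / I_s M ([colon_torsion]).

    Let T be the submodule of the elements of M that are torsion modulo I M. The
    torsion of G_s(n) is the image of I^n T ([torsion_gr]). In particular torsion
    lifts along G_s(n) -> G_(s+1)(n), so that the sequences above remain exact on
    torsion submodules, and the lengths g_s(n) of the torsion of G_s(n) satisfy
      g_s(0) = u_r,  g_s(1) + u_s = u_r + g_(s+1)(1),
      g_s(n+2) = g_s(n+1) + g_(s+1)(n+2),  g_r(n+1) = 0.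
    The torsion of M / (U_s + x_s M) is that of M / I_(s+1) M modulo the image
    of U_s, hence has length u_(s+1) - u_s ([h0quoS]); these differences are the
    k-coefficients of index below r, and u_0 is the last one. Pascal's rule
    solves the recursion in closed form ([binomial_recursion]), and the
    j-coefficients follow because binomial polynomials of distinct degrees are
    independent. *)

Local Notation span := Defs.span.

(** * Submodules *)

Section Submodules.
Variables (R : comNzRingType) (M : lmodType R).
Implicit Types (L N K : set M) (a b : R) (u v w : M).

Lemma submoduleP N :
  submodule N <-> N 0 /\ forall a u v, N u -> N v -> N (a *: u + v).
Proof.
split=> -[N0 NZD].
  split=> [|a u v Nu Nv]; first by rewrite inE in N0.
  by have := NZD a u v; rewrite !inE; apply.
by split=> [|a u v]; rewrite !inE //; apply: NZD.
Qed.

Lemma submod0 N : submodule N -> N 0.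
Proof. by case/submoduleP. Qed.

Lemma submodZ N a v : submodule N -> N v -> N (a *: v).
Proof. by case/submoduleP=> N0 NZD Nv; rewrite -[_ *: _]addr0; apply: NZD. Qed.

Lemma submodD N u v : submodule N -> N u -> N v -> N (u + v).
Proof. by case/submoduleP=> N0 NZD Nu Nv; rewrite -[u]scale1r; apply: NZD. Qed.

Lemma submodN N v : submodule N -> N v -> N (- v).
Proof. by move=> sN Nv; rewrite -scaleN1r; apply: submodZ. Qed.

Lemma submodB N u v : submodule N -> N u -> N v -> N (u - v).
Proof. by move=> sN Nu Nv; apply: submodD (submodN _ _). Qed.

Lemma submod_sum N (I : Type) (s : seq I) (P : pred I) (F : I -> M) :
  submodule N -> (forall i, P i -> N (F i)) -> N (\sum_(i <- s | P i) F i).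
Proof.
by move=> sN NF; apply: big_ind => //; [apply: submod0|move=> *; apply:
  submodD].
Qed.

Lemma submodI L N : submodule L -> submodule N -> submodule (L `&` N).
Proof.
move=> sL sN; apply/submoduleP; split; first by split; apply: submod0.
by move=> a u v [Lu Nu] [Lv Nv]; split; apply: submodD => //; apply: submodZ.
Qed.

Lemma submodT : submodule [set: M].
Proof. by apply/submoduleP. Qed.

Lemma submod_set0 : submodule [set 0 : M].
Proof. by apply/submoduleP; split=> // a u v /= -> ->;
  rewrite scaler0 addr0. Qed.

Lemma span_submod (A : set M) : submodule (span A).
Proof.
apply/submoduleP; split=> [N [sN _]|a u v Au Av N NA]; first exact: submod0.
by apply: submodD NA.1 _ (Av _ NA); apply: submodZ NA.1 (Au _ NA).
Qed.

Lemma subset_span (A : set M) : A `<=` span A.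
Proof. exact: sub_gen_smallest. Qed.

Lemma span_sub (A : set M) N : submodule N -> A `<=` N -> span A `<=` N.
Proof. exact: smallest_sub. Qed.

Definition addm L N : set M :=
  [set v | exists2 a, L a & exists2 b, N b & v = a + b].

Lemma addm_submod L N : submodule L -> submodule N -> submodule (addm L N).
Proof.
move=> sL sN; apply/submoduleP; split.
  by exists 0; [apply: submod0|exists 0; [apply: submod0|rewrite addr0]].
move=> a _ _ [u1 Lu1 [u2 Nu2 ->]] [v1 Lv1 [v2 Nv2 ->]].
exists (a *: u1 + v1); first by apply: submodD => //; apply: submodZ.
exists (a *: u2 + v2); first by apply: submodD => //; apply: submodZ.
by rewrite scalerDr addrACA.
Qed.

Lemma addmI L N u v : L u -> N v -> addm L N (u + v).
Proof. by move=> Lu Nv; exists u => //; exists v. Qed.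

Lemma sub_addml L N : submodule N -> L `<=` addm L N.
Proof. by move=> sN v Lv; rewrite -[v]addr0; apply: addmI (submod0 _). Qed.

Lemma sub_addmr L N : submodule L -> N `<=` addm L N.
Proof. by move=> sL v Nv; rewrite -[v]add0r; apply: addmI (submod0 _) _. Qed.

Lemma addm_sub L N K : submodule K -> L `<=` K -> N `<=` K -> addm L N `<=` K.
Proof. by move=> sK LK NK _ [a La [b Nb ->]]; apply: submodD; auto. Qed.

Lemma addmS L L' N N' :
  L `<=` L' -> N `<=` N' -> addm L N `<=` addm L' N'.
Proof. by move=> LL' NN' _ [a La [b Nb ->]]; apply: addmI; auto. Qed.

Lemma msumE L N : submodule L -> submodule N -> msum L N = addm L N.
Proof.
move=> sL sN; apply/seteqP; split.
  apply: span_sub; first exact: addm_submod.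
  by move=> v [/(sub_addml sN)//|/(sub_addmr sL)].
have ss := span_submod (L `|` N).
apply: addm_sub => // v Lv; apply: subset_span; [by left|by right].
Qed.

Lemma colon_submod N a : submodule N -> submodule (colon N a).
Proof.
move=> sN; apply/submoduleP; rewrite /colon /=; split.
  by rewrite scaler0; apply: submod0.
move=> b u v Nu Nv; rewrite scalerDr scalerA mulrC -scalerA.
by apply: submodD => //; apply: submodZ.
Qed.

(** The cyclic submodule generated by an element, presented by its elements
    so that sums with it can be unpacked directly. *)
Definition cyclic v : set M := [set a *: v | a in [set: R]].

Lemma cyclic_submod v : submodule (cyclic v).
Proof.
apply/submoduleP; split; first by exists 0 => //; rewrite scale0r.
move=> a _ _ [b _ <-] [c _ <-]; exists (a * b + c) => //.
by rewrite scalerDl scalerA.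
Qed.

Lemma cyclic_id v : cyclic v v.
Proof. by exists 1 => //; rewrite scale1r. Qed.

Lemma cyclic_sub v N : submodule N -> N v -> cyclic v `<=` N.
Proof. by move=> sN Nv _ [a _ <-]; apply: submodZ. Qed.

Lemma submod_span_cons v (s : seq M) :
  span [set` v :: s] = addm (cyclic v) (span [set` s]).
Proof.
have ss := span_submod [set` s]; have sv := cyclic_submod v.
apply/seteqP; split.
  apply: span_sub; first exact: addm_submod.
  move=> w /=; rewrite in_cons => /orP[/eqP->|ws].
    exact: (sub_addml ss) (cyclic_id v).
  exact: (sub_addmr sv) (subset_span ws).
apply: addm_sub; first exact: span_submod.
  apply: cyclic_sub; first exact: span_submod.
  by apply: subset_span; rewrite /= mem_head.
apply: span_sub; first exact: span_submod.
by move=> w ws; apply: subset_span; rewrite /= in_cons ws orbT.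
Qed.

Lemma submod_span_nil : span [set` [::]] = [set 0 : M].
Proof.
apply/seteqP; split; first by apply: span_sub; [apply: submod_set0|].
by move=> _ ->; apply: submod0; apply: span_submod.
Qed.

Lemma mscale_submod (J : set R) N : submodule (mscale J N).
Proof. exact: span_submod. Qed.

Lemma mscaleM (J : set R) N a v : J a -> N v -> mscale J N (a *: v).
Proof. by move=> Ja Nv; apply: subset_span; exists a => //; exists v. Qed.

Lemma mscale_sub (J : set R) N K :
  submodule K -> (forall a v, J a -> N v -> K (a *: v)) -> mscale J N `<=` K.
Proof. by move=> sK KJN; apply: span_sub => // _ [a Ja [v Nv <-]]; apply:
  KJN. Qed.

End Submodules.

Lemma scalars_submod (R : comNzRingType) (M : lmodType R) (N : set M) (v : M) :
  submodule N -> @submodule R R^o [set a | N (a *: v)].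
Proof.
move=> sN; apply/submoduleP; split=> [|a b c] /=.
  by rewrite scale0r; apply: submod0.
move=> Nb Nc; rewrite scalerDl -scalerA.
by apply: submodD => //; apply: submodZ.
Qed.

(** * Chains and length *)

Section Length.
Variables (R : comNzRingType) (M : lmodType R).
Implicit Types (L N K : set M).

Lemma chainS L L' N N' n : L' `<=` L -> N `<=` N' ->
  submodule_chain L N n -> submodule_chain L' N' n.
Proof.
move=> L'L NN' [c [sc Lc cN cS]]; exists c.
by split=> //; [apply: subset_trans Lc|apply: subset_trans NN'].
Qed.

Lemma chain0 L N : submodule L -> L `<=` N -> submodule_chain L N 0%N.
Proof. by move=> sL LN; exists (fun=> L); split. Qed.

Lemma chain_cons L K N n : submodule L -> L `<` K ->
  submodule_chain K N n -> submodule_chain L N n.+1.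
Proof.
move=> sL [LK KL] [c [sc Kc cN cS]].
exists (fun i => if i is i'.+1 then c i' else L); split=> //.
- by case=> // i; apply: sc.
- case=> [|i]; last exact: cS.
  move=> _; split=> [|cL]; first exact: subset_trans Kc.
  by apply: KL; apply: subset_trans cL.
Qed.

Lemma chain_uncons L N n : submodule_chain L N n.+1 ->
  exists K, [/\ submodule K, L `<` K & submodule_chain K N n].
Proof.
move=> [c [sc Lc cN cS]]; exists (c 1%N); split; first exact: sc.
  have [c01 c10] := cS 0%N (ltn0Sn n).
  split; first exact: subset_trans c01.
  by move=> c1L; apply: c10; apply: subset_trans Lc.
by exists (fun i => c i.+1); split=> // i lt_in; [apply: sc|apply: cS].
Qed.

Lemma chain_mono (c : nat -> set M) n i j :
  (forall k, (k < n)%N -> c k `<` c k.+1) ->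
  (i <= j)%N -> (j <= n)%N -> c i `<=` c j.
Proof.
move=> cS; elim: j => [|j IHj]; first by rewrite leqn0 => /eqP-> _ v.
rewrite leq_eqVlt => /orP[/eqP-> _ v//|lt_ij] lt_jn.
by apply: subset_trans (IHj lt_ij (ltnW lt_jn)) _; have [] := cS j lt_jn.
Qed.

Lemma chain_sub L N n : submodule_chain L N n -> L `<=` N.
Proof.
move=> [c [_ Lc cN cS]]; apply: subset_trans Lc _; apply: subset_trans cN.
exact: chain_mono cS _ _.
Qed.

Lemma finite_lengthS L L' N N' : L' `<=` L -> N `<=` N' ->
  finite_length L' N' -> finite_length L N.
Proof. by move=> L'L NN' [b bP]; exists b => n /(chainS L'L NN')/bP. Qed.

(** For finite length the supremum is attained, so that the default values in
    the definition of the length do not intervene. *)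
Lemma lengthP L N : submodule L -> L `<=` N -> finite_length L N ->
  submodule_chain L N (length L N) /\
  forall n, submodule_chain L N n -> (n <= length L N)%N.
Proof.
move=> sL LN fLN; have c0 := chain0 sL LN.
have [b bP] := fLN.
have ub n : submodule_chain L N n -> (n <= length L N)%N.
  move=> cn; have := ge_supremum_Nmem 0%N (nat_supremums_neq0 fLN) cn.
  by rewrite leEnat.
split=> //.
have exl : exists n, `[< submodule_chain L N n >] by exists 0%N; apply/asboolP.
have ubl n : `[< submodule_chain L N n >] -> (n <= b)%N.
  by move/asboolP/bP; rewrite leEnat.
case: (ex_maxnP exl ubl) => n /asboolP cn maxn.
suff -> : length L N = n by [].
rewrite /length /supremum; case: ifPn => [/eqP e0|_].
  by move: c0; rewrite e0.
apply: xget_unique.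
  by split=> [k ck|k kP]; [rewrite leEnat; apply/maxn/asboolP|apply: kP].
move=> k [kub klb]; apply/eqP; rewrite eqn_leq; apply/andP; split.
  by have := klb n; rewrite leEnat; apply=> j cj; rewrite leEnat;
    apply/maxn/asboolP.
by have := kub n cn; rewrite leEnat.
Qed.

Lemma length_eq L N l : submodule L -> L `<=` N ->
  submodule_chain L N l -> (forall n, submodule_chain L N n -> (n <= l)%N) ->
  length L N = l.
Proof.
move=> sL LN cl lub; have fLN : finite_length L N.
  by exists l => n /lub; rewrite leEnat.
have [cL Lub] := lengthP sL LN fLN.
by apply/eqP; rewrite eqn_leq lub //= Lub.
Qed.

Lemma chain_cat L K N n k : submodule L ->
  submodule_chain L K n -> submodule_chain K N k ->
  submodule_chain L N (n + k)%N.
Proof.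
elim: n L => [|n IHn] L sL cLK cKN.
  exact: chainS (chain_sub cLK) (@subset_refl _ N) cKN.
have [L' [sL' LL' cL'K]] := chain_uncons cLK.
exact: chain_cons LL' (IHn L' sL' cL'K cKN).
Qed.

(** Each strict step of a chain in N / L stays strict after intersecting with K
    or after adding K, by the modular law. *)
Lemma chain_split L K N n : submodule L -> submodule K -> submodule N ->
  submodule_chain L N n -> exists a b,
  [/\ (n <= a + b)%N, submodule_chain (L `&` K) (N `&` K) a &
      submodule_chain (addm L K) (addm N K) b].
Proof.
move=> sL sK sN; elim: n L sL => [|n IHn] L sL cLN.
  have LN := chain_sub cLN; exists 0%N, 0%N; split=> //.
    by apply: chain0; [apply: submodI|apply: setSI].
  by apply: chain0; [apply: addm_submod|apply: addmS].
have [L' [sL' [LL' L'L] cL'N]] := chain_uncons cLN.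
have [a [b [le_nab ca cb]]] := IHn L' sL' cL'N.
have LK : L `&` K `<=` L' `&` K by apply: setSI.
have LpK : addm L K `<=` addm L' K by apply: addmS.
have [LK'|nLK'] := pselect (L' `&` K `<=` L `&` K); last first.
  exists a.+1, b; split=> //; last exact: chainS cb.
  by apply: chain_cons ca => //; apply: submodI.
exists a, b.+1; split; first by rewrite addnS.
  exact: chainS ca.
apply: chain_cons cb; first exact: addm_submod.
split=> // L'K; apply: L'L => v L'v.
have [l Ll [k Kk vE]] := L'K v (sub_addml sK L'v).
have kE : k = v - l by rewrite vE addrC addKr.
have [|Lk _] := LK' k; first by split=> //; rewrite kE; apply: submodB; auto.
by rewrite vE; apply: submodD.
Qed.

Lemma length_add L K N : submodule L -> submodule K -> submodule N ->
  L `<=` K -> K `<=` N -> finite_length L K -> finite_length K N ->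
  finite_length L N /\ length L N = (length L K + length K N)%N.
Proof.
move=> sL sK sN LK KN fLK fKN.
have [cLK uLK] := lengthP sL LK fLK; have [cKN uKN] := lengthP sK KN fKN.
have ub n : submodule_chain L N n -> (n <= length L K + length K N)%N.
  move=> cn; have [a [b [le_n ca cb]]] := chain_split sL sK sN cn.
  apply: leq_trans le_n _; apply: leq_add.
    apply: uLK; apply: chainS ca; [by move=> v Lv; split=> //; apply: LK|].
    exact: subIsetr.
  apply: uKN; apply: chainS cb; first exact: sub_addmr.
  exact: addm_sub.
have LN : L `<=` N by apply: subset_trans KN.
split; first by exists (length L K + length K N)%N => n /ub; rewrite leEnat.
by apply: length_eq => //; apply: chain_cat cLK cKN.
Qed.

Lemma length_refl L : submodule L -> finite_length L L /\ length L L = 0%N.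
Proof.
move=> sL.
have ub n : submodule_chain L L n -> (n <= 0)%N.
  case: n => // n /chain_uncons[K [_ [_ KL] /chain_sub]].
  by move=> KL'; case: KL.
split; first by exists 0%N => n /ub; rewrite leEnat.
by apply: length_eq => //; apply: chain0.
Qed.

(** The quotient (L + R v) / L is simple or zero: a submodule strictly between L
    and L + R v contains some a v with a not in m; then a is invertible modulo
    m, and m v is in L. *)
Lemma finite_length_cyclic (m : set R) L v : maximal_ideal m -> submodule L ->
  (forall a, m a -> L (a *: v)) -> finite_length L (addm L (cyclic v)).
Proof.
move=> [[m0 m1 mZD] mmax] sL Lmv; exists 1%N => -[|[|n]] //.
case/chain_uncons=> K1 [sK1 [LK1 K1L] cK1].
have [K2 [sK2 [_ K21] cK2]] := chain_uncons cK1; exfalso.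
have sv := cyclic_submod v.
have [w K1w nLw] : exists2 w, K1 w & ~ L w.
  apply: contrapT => nex; apply: K1L => w K1w; apply: contrapT => nLw.
  by apply: nex; exists w.
have [l Ll [_ [a _ <-] wE]] := chain_sub cK1 K1w.
have nma : ~ m a by move=> ma; apply: nLw; rewrite wE; apply: submodD; auto.
have K1av : K1 (a *: v).
  have -> : a *: v = w - l by rewrite wE addrC addKr.
  by apply: submodB; auto.
have mP : m 0 /\ forall c y z, m y -> m z -> m (c * y + z).
  by rewrite inE in m0; split=> // c y z; have := mZD c y z; rewrite !inE;
    apply.
(* By maximality of m, the ideal m + R a is the unit ideal. *)
have [b [c mc bcE]] : exists b, exists2 c, m c & b * a + c = 1.
  apply: contrapT => nex; apply: nma.
  pose K := [set y | exists b, exists2 c, m c & b * a + c = y].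
  have mK : m `<=` K by move=> c mc; exists 0, c => //; rewrite mul0r add0r.
  suff <- : K = m by exists 1, 0; [apply: mP.1|rewrite mul1r addr0].
  apply: mmax => //; split; first by rewrite inE; apply/mK/mP.1.
    by rewrite notin_setE.
  move=> d y z; rewrite !inE => -[b [c mc <-]] [b' [c' mc' <-]].
  exists (d * b + b'), (d * c + c'); first exact: mP.2.
  by rewrite mulrDl mulrDr mulrA addrACA.
have K1v : K1 v.
  rewrite -[v]scale1r -bcE scalerDl -scalerA.
  by apply: submodD => //; [apply: submodZ|apply: LK1; apply: Lmv].
apply: K21; apply: subset_trans (chain_sub cK2) _.
by apply: addm_sub => //; apply: cyclic_sub.
Qed.

End Length.

Lemma chain_map (R : comNzRingType) (M M' : lmodType R) (L N : set M)
    (L' N' : set M') (h : set M -> set M') n :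
  (forall K, submodule K -> L `<=` K -> K `<=` N ->
     [/\ submodule (h K), L' `<=` h K & h K `<=` N']) ->
  (forall K1 K2, submodule K1 -> submodule K2 ->
     L `<=` K1 -> K1 `<` K2 -> K2 `<=` N -> h K1 `<` h K2) ->
  submodule_chain L N n -> submodule_chain L' N' n.
Proof.
move=> hP hlt [c [sc Lc cN cS]].
have lec i : (i <= n)%N -> L `<=` c i.
  by move=> le_in; apply: subset_trans Lc _; apply: chain_mono cS _ le_in.
have cle i : (i <= n)%N -> c i `<=` N.
  by move=> le_in; apply: subset_trans cN; apply: chain_mono cS le_in _.
have hcP i (le_in : (i <= n)%N) :=
  hP _ (sc i le_in) (lec i le_in) (cle i le_in).
exists (h \o c); split=> /=.
- by move=> i le_in; have [] := hcP i le_in.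
- by have [] := hcP 0%N (leq0n n).
- by have [] := hcP n (leqnn n).
- move=> i lt_in; apply: hlt; [exact/sc/ltnW|exact: sc|exact/lec/ltnW| |].
    exact: cS.
  exact: cle.
Qed.

(** The hypotheses say that f induces a map N / L -> N' / L' which is injective
    and surjective; submodules of the two quotients then correspond by image
    and preimage. *)
Lemma length_iso (R : comNzRingType) (M M' : lmodType R) (f : {linear M -> M'})
    (L N : set M) (L' N' : set M') :
  submodule N -> submodule L' -> submodule N' -> L `<=` N -> L' `<=` N' ->
  (forall v, N v -> N' (f v)) ->
  (forall v, N v -> L' (f v) <-> L v) ->
  (forall v', N' v' -> exists2 v, N v & L' (v' - f v)) ->
  length L N = length L' N'.
Proof.
move=> sN sL' sN' LN L'N' fN fL fsurj.
rewrite /length; congr (supremum _ _); apply/seteqP; split=> n.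
- apply: (@chain_map _ _ _ _ _ _ _ (fun K => addm L' [set f v | v in K])).
    move=> K sK LK KN; split.
    + apply: addm_submod => //; apply/submoduleP; split.
        by exists 0; [apply: submod0|rewrite raddf0].
      move=> a _ _ [u Ku <-] [v Kv <-]; exists (a *: u + v);
        last by rewrite linearP.
      by apply: submodD => //; apply: submodZ.
    + by move=> v L'v; rewrite -[v]addr0; apply: addmI => //; exists 0;
        [apply: submod0|rewrite raddf0].
    + by apply: addm_sub => // _ [v Kv <-]; apply/fN/KN.
  move=> K1 K2 sK1 sK2 LK1 [K12 K21] K2N; split.
    by apply: addmS => // _ [v K1v <-]; exists v => //; apply: K12.
  move=> hK; apply: K21 => v K2v.
  have [|l L'l [_ [w K1w <-] fvE]] := hK (f v).
    by rewrite -[f v]add0r; apply: addmI; [apply: submod0|exists v].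
  rewrite -[v](subrK w); apply: submodD => //; apply: LK1; apply/fL.
    by apply: submodB => //; apply: K2N => //; apply: K12.
  by rewrite linearB fvE addrK.
- apply: (@chain_map _ _ _ _ _ _ _ (fun K' => N `&` [set v | K' (f v)])).
    move=> K sK LK KN; split.
    + apply: submodI => //; apply/submoduleP; split=> /=.
        by rewrite raddf0; apply: submod0.
      by move=> a u v Ku Kv; rewrite linearP; apply: submodD => //; apply:
        submodZ.
    + by move=> v Lv; split; [apply: LN|apply/LK/fL => //; apply: LN].
    + by move=> v [].
  move=> K1 K2 sK1 sK2 LK1 [K12 K21] K2N; split.
    by move=> v [Nv K1v]; split=> //; apply: K12.
  move=> hK; apply: K21 => v K2v; have [w Nw L'w] := fsurj v (K2N v K2v).
  rewrite -[v](subrK (f w)); apply: submodD => //; first exact: LK1.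
  have [|//] := hK w; split=> //=.
  rewrite -[f w](subKr v); apply: submodB => //.
  exact/K12/LK1.
Qed.

Lemma length_addm (R : comNzRingType) (M : lmodType R) (L N : set M) :
  submodule L -> submodule N ->
  length L (addm L N) = length (L `&` N) N.
Proof.
move=> sL sN; apply/esym; apply: (@length_iso _ _ _ idfun) => //.
- exact: addm_submod.
- exact: sub_addml.
- by move=> v Nv; apply: sub_addmr.
- by move=> v Nv; split=> [|[]].
- by move=> _ [l Ll [v Nv ->]]; exists v => //=; rewrite addrK.
Qed.

(** * Torsion and finite length over a Noetherian local ring *)

(** The coefficients along the first generator of the elements of N form an
    ideal; lifts of generators of this ideal account for N up to a submodule of
    the span of the remaining generators. *)
Lemma noetherian_sub (R : comNzRingType) (M : lmodType R)
    (noethR : noetherian R) (s : seq M) (N : set M) :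
  submodule N -> N `<=` span [set` s] -> finitely_generated N.
Proof.
elim: s N => [|a s IHs] N sN Ns.
  exists [::]; rewrite submod_span_nil in Ns *; apply/seteqP; split=> // _ ->.
  exact: submod0.
have ss := span_submod [set` s].
pose J := [set c | exists2 w, span [set` s] w & N (c *: a + w)].
have [t JE] : @finitely_generated R R^o J.
  apply: noethR; apply/submoduleP; split.
    by exists 0; [apply: submod0|rewrite scale0r addr0; apply: submod0].
  move=> b c d [u su Nu] [v sv Nv]; exists (b *: u + v).
    by apply: (submodD ss) => //; apply: (submodZ _ ss).
  rewrite scalerDl -scalerA addrACA -scalerDr.
  by apply: submodD => //; apply: submodZ.
have [s' s'E] : finitely_generated (N `&` span [set` s]).
  by apply: IHs; [apply: submodI|move=> v []].
have /boolp.choice[phi phiP] c : exists w, J c ->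
    span [set` s] w /\ N (c *: a + w).
  have [[w sw Nw]|nJc] := pselect (J c); first by exists w.
  by exists 0.
pose t' := [seq c *: a + phi c | c <- t].
have sts' := span_submod [set` t' ++ s'].
have tP : span [set` t] `<=`
    [set c | exists2 w, span [set` s] w & span [set` t' ++ s'] (c *: a + w)].
  apply: span_sub.
    apply/submoduleP; split.
      by exists 0; [apply: submod0|rewrite scale0r addr0; apply: submod0].
    move=> b c d [u su Nu] [v sv Nv]; exists (b *: u + v).
      by apply: (submodD ss) => //; apply: (submodZ _ ss).
    rewrite scalerDl -scalerA addrACA -scalerDr.
    by apply: (submodD sts') => //; apply: (submodZ _ sts').
  move=> c ct; exists (phi c).
    by apply: (phiP _ _).1; rewrite JE; apply: subset_span.
  apply: subset_span; rewrite /= mem_cat.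
  by rewrite (map_f (fun d => d *: a + phi d) ct).
have ts'N : span [set` t' ++ s'] `<=` N.
  apply: span_sub => // v; rewrite /= mem_cat => /orP[/mapP[c ct ->]|vs'].
    by apply: (phiP _ _).2; rewrite JE; apply: subset_span.
  by have [] : (N `&` span [set` s]) v by rewrite s'E; apply: subset_span.
exists (t' ++ s'); apply/seteqP; split=> //.
move=> v Nv; have := Ns v Nv;
  rewrite submod_span_cons => -[_ [c _ <-] [w sw vE]].
have [|w' sw' tw'] := tP c; first by rewrite -JE; exists w; rewrite // -vE.
rewrite -[v](subrK (c *: a + w')); apply: (submodD sts') => //.
have : (N `&` span [set` s]) (v - (c *: a + w')).
  split; first by apply: submodB => //; apply: ts'N.
  by rewrite vE opprD addrACA subrr add0r; apply: (submodB ss).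
rewrite s'E; apply: span_sub => // u us'.
by apply: subset_span; rewrite /= mem_cat us' orbT.
Qed.

Section Torsion.
Variables (R : comNzRingType) (m : set R).

Lemma ideal_pow_submod k : @submodule R R^o (ideal_pow m k).
Proof. by case: k => [|k]; [apply: submodT|apply: mscale_submod]. Qed.

Lemma ideal_powS k a b : m a -> ideal_pow m k b -> ideal_pow m k.+1 (a * b).
Proof. exact: (@mscaleM R R^o). Qed.

Lemma ideal_pow_leq k l : (k <= l)%N -> ideal_pow m l `<=` ideal_pow m k.
Proof.
elim: l => [|l IHl]; first by rewrite leqn0 => /eqP-> a.
rewrite leq_eqVlt => /orP[/eqP-> a//|le_kl].
apply: (mscale_sub (ideal_pow_submod k)) => a b _ /(IHl le_kl) mb.
exact: (submodZ _ (ideal_pow_submod k)).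
Qed.

Lemma ideal_pow_expr k a : m a -> ideal_pow m k (a ^+ k).
Proof. by move=> ma; elim: k => // k IHk; rewrite exprS; apply: ideal_powS. Qed.

Variables (M : lmodType R).
Implicit Types (L N K : set M).

Lemma torsion_submod L N :
  submodule L -> submodule N -> submodule (torsion m L N).
Proof.
move=> sL sN; apply/submoduleP; split.
  split; first exact: submod0.
  by exists 0%N => a _; rewrite scaler0; apply: submod0.
move=> a u v [Nu [k uk]] [Nv [l vl]]; split.
  by apply: submodD => //; apply: submodZ.
exists (maxn k l) => b mb; rewrite scalerDr scalerA mulrC -scalerA.
apply: submodD => //; first apply: submodZ => //.
  by apply: uk; apply: ideal_pow_leq mb; apply: leq_maxl.
by apply: vl; apply: ideal_pow_leq mb; apply: leq_maxr.
Qed.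

Lemma sub_torsion L N : submodule L -> L `<=` N -> L `<=` torsion m L N.
Proof.
move=> sL LN v Lv; split; first exact: LN.
by exists 0%N => a _; apply: submodZ.
Qed.

Lemma torsionS L L' N N' :
  L `<=` L' -> N `<=` N' -> torsion m L N `<=` torsion m L' N'.
Proof.
move=> LL' NN' v [Nv [k vk]]; split; first exact: NN'.
by exists k => a /vk/LL'.
Qed.

Hypothesis localR : local_ring m.

Lemma local_ideal : @submodule R R^o m.
Proof.
have [[[m0 _ mZD] _] _] := localR; apply/submoduleP; split.
  by rewrite inE in m0.
by move=> a u v; have := mZD a u v; rewrite !inE; apply.
Qed.

(** Induction along a composition series: a simple subquotient K / L is killed
    by m, because the annihilator of each nonzero class is a maximal ideal. *)
Lemma finite_length_pow L N : submodule L -> submodule N -> L `<=` N ->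
  finite_length L N ->
  exists k, forall a v, ideal_pow m k a -> N v -> L (a *: v).
Proof.
move=> sL sN LN fLN; have [cn ub] := lengthP sL LN fLN.
exists (length L N); move: (length L N) => n in cn ub *.
elim: n L sL {LN fLN} cn ub => [|n IHn] L sL cn ub a v.
  move=> _ Nv; apply: submodZ => //.
  have LN := chain_sub cn; apply: contrapT => nLv.
  have // : (1 <= 0)%N.
  by apply: ub; apply: chain_cons (chain0 sN _) => //; split=> // /(_ v Nv).
have [K [sK [LK KL] cK]] := chain_uncons cn.
have KN := chain_sub cK.
have IHK : forall a v, ideal_pow m n a -> N v -> K (a *: v).
  by apply: IHn => // k ck; rewrite -ltnS; apply: ub; apply: chain_cons ck.
have mK b w : m b -> K w -> L (b *: w).
  move=> mb Kw; have [Lw|nLw] := pselect (L w); first exact: submodZ.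
  suff mE : [set c | L (c *: w)] = m by move: mb; rewrite -mE.
  (* The annihilator of the class of w is proper; if J is an ideal above it,
     then L + J w is L or K because the chain through K is a longest one. *)
  apply: localR.2; split.
    split; first by rewrite inE /= scale0r; apply: submod0.
      by rewrite notin_setE /= scale1r.
    move=> c x y; rewrite !inE /= => Lx Ly; rewrite scalerDl -scalerA.
    by apply: submodD => //; apply: submodZ.
  move=> J [J0 J1 JZD] JL; apply/seteqP; split=> // c Jc.
  have J0' : J 0 by rewrite inE in J0.
  have JZD' d y z : J y -> J z -> J (d * y + z).
    by have := JZD d y z; rewrite !inE; apply.
  rewrite notin_setE in J1.
  pose L1 := addm L [set d *: w | d in J].
  have sL1 : submodule L1.
    apply: addm_submod => //; apply/submoduleP; split.
      by exists 0; rewrite ?scale0r.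
    move=> d _ _ [e Je <-] [f Jf <-]; exists (d * e + f); first exact: JZD'.
    by rewrite scalerDl scalerA.
  have LL1 : L `<=` L1.
    by move=> l Ll; rewrite -[l]addr0; apply: addmI => //; exists 0;
      rewrite ?scale0r.
  have L1K : L1 `<=` K.
    by apply: addm_sub => // _ [d _ <-]; apply: submodZ.
  have nKL1 : ~ K `<=` L1.
    move=> /(_ w Kw) [l Ll [_ [d Jd <-] wE]]; apply: J1.
    have -> : 1 = 1 * d + (1 - d) by rewrite mul1r addrC subrK.
    by apply: JZD' => //; apply: JL; rewrite /= scalerBl scale1r {1}wE addrK.
  have : L1 `<=` L.
    apply: contrapT => nL1L.
    (* Inserting L1 between L and K would make the chain too long. *)
    have : (n.+2 <= n.+1)%N.
      apply: ub; apply: (chain_cons sL (K := L1)); first by split.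
      by apply: (chain_cons sL1 (K := K)).
    by rewrite ltnn.
  apply; rewrite -[c *: w]add0r; apply: addmI; first exact: submod0.
  by exists c.
move=> ma Nv; move: a ma; apply: (mscale_sub (scalars_submod v sL)).
by move=> b c mb mc; rewrite /= -scalerA; apply: mK => //; apply: IHK.
Qed.

(** The generators are added one at a time, so each has to generate a module of
    finite length modulo any submodule above L; torsion elements do. *)
Lemma finite_length_span (s : seq M) L : submodule L ->
  (forall v K, v \in s -> submodule K -> L `<=` K ->
     finite_length K (addm K (cyclic v))) ->
  finite_length L (addm L (span [set` s])).
Proof.
elim: s L => [|v s IHs] L sL fs.
  apply: (@finite_lengthS _ _ _ L _ L) => //; last by have [] := length_refl sL.
  by apply: addm_sub => //; rewrite submod_span_nil => _ ->; apply: submod0.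
have sv := cyclic_submod v; have ss := span_submod [set` s].
have sLv : submodule (addm L (cyclic v)) by apply: addm_submod.
have LLv : L `<=` addm L (cyclic v) by apply: sub_addml.
have fLv : finite_length L (addm L (cyclic v)) by apply: fs; rewrite ?mem_head.
have fLvs : finite_length (addm L (cyclic v))
    (addm (addm L (cyclic v)) (span [set` s])).
  apply: IHs => // u K us sK LvK; apply: fs => //.
    by rewrite in_cons us orbT.
  exact: subset_trans LvK.
have [||f _] := length_add sL sLv _ LLv _ fLv fLvs.
- exact: addm_submod.
- exact: sub_addml.
apply: finite_lengthS f => //; rewrite submod_span_cons.
by move=> _ [l Ll [_ [u vu [w sw ->]] ->]]; rewrite addrA; do !apply: addmI.
Qed.

Hypothesis noethR : noetherian R.

(** By induction on k, with m generated by finitely many g: each g v is killed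
    by m ^ k modulo L, so (L + m v) / L has finite length, and m kills v modulo
    L + m v. *)
Lemma finite_length_cyclic_torsion k v L : submodule L ->
  (forall a, ideal_pow m k a -> L (a *: v)) ->
  finite_length L (addm L (cyclic v)).
Proof.
elim: k v L => [|k IHk] v L sL mv.
  have Lv : L v by rewrite -[v]scale1r; apply: mv.
  apply: (@finite_lengthS _ _ _ L _ L) => //; last by have [] := length_refl sL.
  by apply: addm_sub => //; apply: cyclic_sub.
have [t tE] := noethR local_ideal.
have mt c : c \in t -> m c by move=> ct; rewrite tE; apply: subset_span.
pose s := [seq c *: v | c <- t].
have ss := span_submod [set` s]; have sv := cyclic_submod v.
pose K := addm L (span [set` s]); have sK : submodule K by apply: addm_submod.
have LK : L `<=` K by apply: sub_addml.
have fLK : finite_length L K.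
  apply: finite_length_span => // _ K' /mapP[c ct ->] sK' LK'.
  apply: IHk => // a ma; apply: LK'; rewrite scalerA mulrC; apply: mv.
  by apply: ideal_powS => //; apply: mt.
have fKv : finite_length K (addm K (cyclic v)).
  apply: (finite_length_cyclic localR.1) => // a.
  rewrite tE; move: a; apply: (span_sub (scalars_submod v sK)) => c ct.
   apply: (sub_addmr sL); apply: subset_span.
  exact: map_f.
have [||f _] := length_add sL sK _ LK _ fLK fKv.
- exact: addm_submod.
- exact: sub_addml.
by apply: finite_lengthS f => //; apply: addmS.
Qed.

Hypothesis finM : finitely_generated [set: M].

Lemma finite_length_torsion L N :
  submodule L -> finite_length L (torsion m L N).
Proof.
move=> sL; have [s0 s0E] := finM.
have sT : submodule (torsion m L setT).
  by apply: torsion_submod => //; apply: submodT.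
have [s sE] : finitely_generated (torsion m L setT).
  by apply: (noetherian_sub noethR (s := s0)) => //; rewrite -s0E.
apply: (@finite_lengthS _ _ _ L _ (addm L (span [set` s]))) => //.
  rewrite -sE; apply: subset_trans (sub_addmr sL).
  exact: torsionS.
apply: finite_length_span => // v K vs sK LK.
have [_ [k vk]] : torsion m L setT v by rewrite sE; apply: subset_span.
by apply: (finite_length_cyclic_torsion (k := k)) => // a /vk/LK.
Qed.

(** Length is additive inside the torsion of M / L, where everything has finite
    length. *)
Lemma length_add_torsion L K N : submodule L -> submodule K -> submodule N ->
  L `<=` K -> K `<=` N -> N `<=` torsion m L setT ->
  length L N = (length L K + length K N)%N.
Proof.
move=> sL sK sN LK KN NT; have fLT := finite_length_torsion setT sL.
have [] // := length_add sL sK sN LK KN.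
- by apply: finite_lengthS fLT => //; apply: subset_trans KN _.
- by apply: finite_lengthS fLT.
Qed.

End Torsion.

(** * Sequences acting on submodules *)

Section SeqMul.
Variables (R : comNzRingType) (M : lmodType R) (y : nat -> R).
Implicit Types (L N K : set M) (v w : M) (s t n r : nat).

(** I_s N for I_s = (y_0, ..., y_(s-1)), by recursion on s: proofs on
    d-sequences peel off the last element of the sequence. *)
Fixpoint seqmul s N : set M :=
  if s is s'.+1 then addm (seqmul s' N) [set y s' *: v | v in N] else [set 0].

Lemma scale_submod a N : submodule N -> submodule [set a *: v | v in N].
Proof.
move=> sN; apply/submoduleP; split; first by exists 0; rewrite ?scaler0 //;
  apply: submod0.
move=> b _ _ [u Nu <-] [v Nv <-]; exists (b *: u + v).
  by apply: submodD => //; apply: submodZ.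
by rewrite scalerDr !scalerA mulrC.
Qed.

Lemma seqmul_submod s N : submodule N -> submodule (seqmul s N).
Proof.
move=> sN; elim: s => [|s IHs]; first exact: submod_set0.
by apply: addm_submod => //; apply: scale_submod.
Qed.

Lemma seqmulE s N u v : seqmul s N u -> N v -> seqmul s.+1 N (u + y s *: v).
Proof. by move=> Nu Nv; apply: addmI => //; exists v. Qed.

Lemma seqmul_ind s N K : submodule K ->
  (forall k v, (k < s)%N -> N v -> K (y k *: v)) -> seqmul s N `<=` K.
Proof.
move=> sK; elim: s => [|s IHs] NK; first by move=> _ ->; apply: submod0.
apply: addm_sub => //; first by apply: IHs => k v /ltnW; apply: NK.
by move=> _ [v Nv <-]; apply: NK.
Qed.

Lemma seqmul_leq s t N :
  submodule N -> (s <= t)%N -> seqmul s N `<=` seqmul t N.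
Proof.
move=> sN; elim: t => [|t IHt]; first by rewrite leqn0 => /eqP-> v.
rewrite leq_eqVlt => /orP[/eqP-> v//|le_st].
apply: subset_trans (IHt le_st) _; apply: sub_addml; exact: scale_submod.
Qed.

Lemma seqmulM s N k v : submodule N -> (k < s)%N -> N v -> seqmul s N (y k *:
  v).
Proof.
move=> sN lt_ks Nv; apply: (seqmul_leq sN lt_ks).
rewrite -[_ *: _]add0r.
exact: seqmulE (submod0 (seqmul_submod k sN)) Nv.
Qed.

Lemma seqmul_mul s N N' a : submodule N' -> (forall v, N v -> N' (a *: v)) ->
  forall v, seqmul s N v -> seqmul s N' (a *: v).
Proof.
move=> sN' NN'; apply: seqmul_ind => [|k v lt_ks Nv].
  by apply: colon_submod; apply: seqmul_submod.
rewrite /colon /= scalerA mulrC -scalerA.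
by apply: seqmulM => //; apply: NN'.
Qed.

Lemma seqmulS s N N' : submodule N' -> N `<=` N' -> seqmul s N `<=` seqmul s N'.
Proof.
move=> sN' NN'; apply: seqmul_ind => [|k v lt_ks Nv]; first exact:
  seqmul_submod.
by apply: seqmulM => //; apply: NN'.
Qed.

Lemma seqmul_sub s N : submodule N -> seqmul s N `<=` N.
Proof. by move=> sN; apply: seqmul_ind => // k v _; apply: submodZ. Qed.

Definition seqpow r n N : set M := iter n (seqmul r) N.

Lemma seqpow_submod r n N : submodule N -> submodule (seqpow r n N).
Proof. by move=> sN; elim: n => // n IHn; apply: seqmul_submod. Qed.

Lemma seqpowS r n N N' : submodule N' -> N `<=` N' ->
  seqpow r n N `<=` seqpow r n N'.
Proof.
move=> sN' NN'; elim: n => // n IHn.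
by apply: seqmulS => //; apply: seqpow_submod.
Qed.

Lemma seqpowM r n N k v : submodule N -> (k < r)%N ->
  seqpow r n N v -> seqpow r n.+1 N (y k *: v).
Proof.
move=> sN lt_kr Nv; rewrite /seqpow iterS.
have sNn := seqpow_submod r n sN.
exact: (seqmulM sNn lt_kr Nv).
Qed.

End SeqMul.

(** * d-sequences *)

Section DSequence.
Variables (R : comNzRingType) (M : lmodType R) (y : nat -> R) (r : nat).
Implicit Types (L N K : set M) (v w p : M) (s t n : nat).

Local Notation D := (seqmul y).
Local Notation IM s := (seqmul y s [set: M]).
Local Notation U s := (colon (IM s) (y s)).
Local Notation P n := (seqpow y r n [set: M]).

Hypothesis dseq : forall i j v, (i <= j)%N -> (j < r)%N ->
  IM i ((y i * y j) *: v) -> IM i (y j *: v).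

Let sIM s : submodule (IM s). Proof. exact/seqmul_submod/submodT. Qed.
Let sU s : submodule (U s). Proof. exact: colon_submod. Qed.
Let sP n : submodule (P n). Proof. exact/seqpow_submod/submodT. Qed.

Lemma colon_dseq s t v : (s <= t)%N -> (t < r)%N -> U s v -> IM s (y t *: v).
Proof.
move=> le_st lt_tr Uv; apply: dseq => //.
by rewrite mulrC -scalerA; apply: submodZ.
Qed.

Lemma sub_colon_dseq s : IM s `<=` U s.
Proof. by move=> v; apply: submodZ. Qed.

(** If v = u + y_t w with u in I_t M, then y_t v in I_s M gives
    y_t ^ 2 w in I_t M, and the defining property of d-sequences at (t, t)
    removes one factor: v is already in I_t M. *)
Lemma colon_dseq_cap s v : (s < r)%N -> U s v -> IM r v -> IM s v.
Proof.
move=> lt_sr Uv; suff IHt t : (s <= t)%N -> (t <= r)%N -> IM t v -> IM s v.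
  exact: IHt (ltnW lt_sr) (leqnn r).
elim: t => [|t IHt]; first by rewrite leqn0 => /eqP->.
rewrite leq_eqVlt => /orP[/eqP-> //|lt_st] lt_tr IMv.
apply: IHt (ltnW lt_tr) _ => //.
have := IMv; move=> [u IMu [_ [w _ <-] vE]]; rewrite vE.
apply: submodD => //; apply: dseq => //; rewrite -scalerA.
have -> : y t *: w = v - u by rewrite vE addrC addKr.
rewrite scalerBr; apply: submodB => //; last exact: submodZ.
apply: (seqmul_leq (@submodT _ M) (lt_st : (s <= t)%N)).
exact: colon_dseq.
Qed.

(** Descending induction on s from r, where there is nothing to prove. An element
    of I_(s+1) I^n M is u + y_s w with u in I_s I^n M and w in I^n M; if it is
    in I_s M, then so is w by [colon_dseq_cap], and induction on n applies
    to w. *)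
Lemma seqmul_cap_pow n s v : (s <= r)%N -> IM s v -> P n.+1 v -> D s (P n) v.
Proof.
elim: n s v => [|n IHn] s v le_sr // IMv Pv.
suff IHk k t w : (t + k = r)%N -> IM t w -> P n.+2 w -> D t (P n.+1) w.
  by apply: (IHk (r - s)%N) => //; rewrite subnKC.
elim: k t w {s v le_sr IMv Pv} => [|k IHk] t w; first by rewrite addn0 => ->.
rewrite addnS -addSn => tk IMw Pw.
have lt_tr : (t < r)%N by rewrite -tk leq_addr.
have := IHk t.+1 w tk (seqmul_leq (@submodT _ M) (leqnSn t) IMw) Pw.
case=> u Du [_ [p Pp <-] wE].
have IMu : IM t u by apply: seqmulS Du => //; apply: submodT.
have IMp : IM t p.
  apply: colon_dseq_cap => //.
    rewrite /colon /=; have -> : y t *: p = w - u by rewrite wE addrC addKr.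
    exact: submodB.
  by apply: seqmulS Pp => //; apply: submodT.
rewrite wE; apply: submodD Du _; first exact: seqmul_submod.
apply: (seqmul_mul _ _ (IHn _ _ (ltnW lt_tr) IMp Pp)) => // q Pq.
by apply: seqpowM => //; apply: submodT.
Qed.

(** On the associated graded module of M / I_s M, this says that the kernel of
    multiplication by y_s, from degree n - 1 to degree n, comes from U_s. *)
Lemma mul_dseq_inj n s w : (s < r)%N ->
  addm (IM s) (P n.+1) (y s *: w) -> addm (U s) (P n) w.
Proof.
move=> lt_sr [u IMu [b Pb wE]].
have IMb : IM s.+1 b.
  have -> : b = - u + y s *: w by rewrite wE addKr.
  by apply: seqmulE => //; apply: submodN.
have [b' Db' [_ [c Pc <-] bE]] := seqmul_cap_pow lt_sr IMb Pb.
rewrite -[w](subrK c); apply: addmI => //; rewrite /colon /=.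
rewrite scalerBr wE bE addrA addrK; apply: submodD => //.
by apply: seqmulS Db' => //; apply: submodT.
Qed.

(** In positive degree the kernel found in [mul_dseq_inj] disappears, by
    [colon_dseq_cap]. *)
Lemma mul_dseq_inj_pos n s w : (s < r)%N -> IM r w ->
  addm (IM s) (P n.+2) (y s *: w) -> addm (IM s) (P n.+1) w.
Proof.
move=> lt_sr IMw /(mul_dseq_inj lt_sr)[u Uu [c Pc wE]]; rewrite wE.
apply: addmI => //; apply: colon_dseq_cap => //.
have -> : u = w - c by rewrite wE addrK.
by apply: submodB => //; apply: seqmulS Pc => //; apply: submodT.
Qed.

(** * Torsion in the associated graded modules *)

Variable m : set R.
Hypothesis localR : local_ring m.
Hypothesis ym : forall s, (s < r)%N -> m (y s).
Hypothesis colon_pow : forall s, (s < r)%N ->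
  exists k, forall a v, ideal_pow m k a -> U s v -> IM s (a *: v).

Local Notation T := (torsion m (IM r) setT).
Let sT : submodule T. Proof. by apply: torsion_submod => //; apply:
  submodT. Qed.

Lemma ideal_pow_add k l L v : submodule L ->
  (forall a b, ideal_pow m k a -> ideal_pow m l b -> L (a *: (b *: v))) ->
  forall c, ideal_pow m (k + l) c -> L (c *: v).
Proof.
move=> sL; elim: k v => [|k IHk] v Lab.
  by move=> c mc; rewrite -[_ *: _]scale1r; apply: Lab.
apply: (mscale_sub (scalars_submod v sL)) => b c mb mc.
change (L ((b * c) *: v)); rewrite mulrC -scalerA; apply: IHk mc => a d ma md.
rewrite !scalerA [_ * b]mulrC mulrA -scalerA.
by apply: Lab => //; apply: ideal_powS.
Qed.

(** One exponent k has to serve all of K, because the elements b v of K with b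
    in m^l have no common exponent otherwise. *)
Lemma torsion_trans k L K N : submodule L ->
  (forall a v, ideal_pow m k a -> K v -> L (a *: v)) ->
  torsion m K N `<=` torsion m L N.
Proof.
move=> sL KL v [Nv [l vl]]; split=> //; exists (k + l)%N.
by apply: ideal_pow_add => // a b ma mb; apply: KL => //; apply: vl.
Qed.

(** U_s is torsion by amenability; conversely, if a power of y_s multiplies v
    into I_s M then so does y_s, by the defining property of d-sequences. *)
Lemma colon_torsion s : (s < r)%N -> U s = torsion m (IM s) setT.
Proof.
move=> lt_sr; apply/seteqP; split=> v.
  by move=> Uv; split=> //; have [k kP] := colon_pow lt_sr; exists k => a /kP;
    apply.
move=> [_ [k]]; move=> /(_ _ (ideal_pow_expr k (ym lt_sr))); elim:
  k => [|k IHk].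
  by rewrite expr0 scale1r; apply: submodZ.
case: k IHk => // k IHk; rewrite !exprS mulrA -scalerA => ykv; apply: IHk.
by rewrite exprS -scalerA; apply: dseq.
Qed.

Lemma seqpow_torsion n : seqpow y r n T `<=` torsion m (P n.+1) setT.
Proof.
have sTn k : submodule (torsion m (P k) setT).
  by apply: torsion_submod => //; apply: submodT.
elim: n => // n IHn; apply: seqmul_ind => // k v lt_kr /IHn[_ [l vl]].
split=> //; exists l => a /vl Pav; rewrite scalerA mulrC -scalerA.
by apply: seqpowM => //; apply: submodT.
Qed.

(** Modulo I_s M + I^(n+1) M, the image of I^n T in the degree n part of the
    associated graded module of M / I_s M. This explicit form of its torsion,
    justified by [torsion_gr], is what makes torsion lift from M / I_(s+1) M to
    M / I_s M. *)
Definition grtorsion s n : set M :=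
  addm (IM s) (addm (seqpow y r n T) (P n.+1)).
Local Notation E := grtorsion.

Let sE s n : submodule (E s n).
Proof. by apply: addm_submod => //; apply: addm_submod => //; apply:
  seqpow_submod. Qed.
Let sIP s n : submodule (addm (IM s) (P n)).
Proof. exact: addm_submod. Qed.
Let sTn s n : submodule (torsion m (addm (IM s) (P n)) setT).
Proof. by apply: torsion_submod => //; apply: submodT. Qed.

Lemma seqpow_leq n k : (n <= k)%N -> P k `<=` P n.
Proof.
elim: k => [|k IHk]; first by rewrite leqn0 => /eqP-> v.
rewrite leq_eqVlt => /orP[/eqP-> v//|le_nk] v.
by move=> /(seqmul_sub (sP k)); apply: IHk.
Qed.

Lemma seqmulT_leq s t : (s <= t)%N -> IM s `<=` IM t.
Proof. exact/seqmul_leq/submodT. Qed.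

Lemma seqpow_sub_seqmul n : P n.+1 `<=` IM r.
Proof. by apply: seqmulS => //; apply: submodT. Qed.

Lemma grtorsion_sub s n : E s n `<=` addm (IM s) (P n).
Proof.
apply: addm_sub => //; first exact: sub_addml.
apply: subset_trans (sub_addmr (sIM s)); apply: addm_sub => //.
  by apply: seqpowS => //; apply: submodT.
exact: seqpow_leq.
Qed.

Lemma seqmul_sub_grtorsion s n : IM s `<=` E s n.
Proof. by apply: sub_addml; apply: addm_submod => //; apply: seqpow_submod. Qed.

Lemma sub_grtorsion s n : addm (IM s) (P n.+1) `<=` E s n.
Proof.
apply: addmS => //; apply: sub_addmr; exact: seqpow_submod.
Qed.

Lemma grtorsion_torsion s n :
  E s n `<=` torsion m (addm (IM s) (P n.+1)) setT.
Proof.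
have IPt := sub_torsion m (sIP s n.+1) (@subsetT _ _).
apply: addm_sub => //; first by apply: subset_trans IPt; apply: sub_addml.
apply: addm_sub => //.
  apply: subset_trans (seqpow_torsion (n := n)) _; apply: torsionS => //.
  exact: sub_addmr.
by apply: subset_trans IPt; apply: sub_addmr.
Qed.

Lemma grtorsion0 s : (s <= r)%N -> E s 0 = T.
Proof.
move=> le_sr; have IMT := sub_torsion m (sIM r) (@subsetT _ _).
apply/seteqP; split.
  by apply: addm_sub => //; [apply: subset_trans IMT; apply: seqmulT_leq|
    apply: addm_sub].
move=> v Tv; apply: (sub_addmr (sIM s)); exact: sub_addml.
Qed.

Lemma grtorsionM s n v : (s < r)%N -> E s n v -> E s n.+1 (y s *: v).
Proof.
move=> lt_sr [u IMu [_ [t Tt [p Pp ->]] ->]]; rewrite !scalerDr.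
apply: addmI; first exact: submodZ.
apply: addmI; first exact: seqpowM.
by apply: seqpowM => //; apply: submodT.
Qed.

(** Torsion can be divided by y_s: [mul_dseq_inj] loses only U_s, which is
    itself torsion modulo I_s M. *)
Lemma torsion_mul_dseq s n p : (s < r)%N ->
  torsion m (addm (IM s) (P n.+2)) setT (y s *: p) ->
  torsion m (addm (IM s) (P n.+1)) setT p.
Proof.
move=> lt_sr [_ [k kP]]; have [l lU] := colon_pow lt_sr.
apply: (@torsion_trans l _ (addm (U s) (P n.+1))) => //; last first.
  split=> //; exists k => a /kP; rewrite scalerA mulrC -scalerA.
  exact: mul_dseq_inj.
move=> a _ ma [u Uu [q Pq ->]]; rewrite scalerDr.
by apply: addmI; [apply: lU|apply: submodZ].
Qed.

(** Same double induction as for [seqmul_cap_pow]; here division of a torsion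
    element by y_s is possible by [torsion_mul_dseq]. *)
Lemma torsion_grtorsion n s w : (s <= r)%N -> P n w ->
  torsion m (addm (IM s) (P n.+1)) setT w -> E s n w.
Proof.
elim: n s w => [|n IHn] s w le_sr Pw tw.
  rewrite grtorsion0 //; move: w tw {Pw}; apply: torsionS => //.
  by apply: addm_sub => //; apply: seqmulT_leq.
(* Descending induction on t = r - k. *)
suff IHk k t v : (t + k = r)%N -> P n.+1 v ->
    torsion m (addm (IM t) (P n.+2)) setT v -> E t n.+1 v.
  by apply: (IHk (r - s)%N) => //; rewrite subnKC.
elim: k t v {s w le_sr Pw tw} => [|k IHk] t v.
  by rewrite addn0 => -> /seqpow_sub_seqmul Pv _; apply: seqmul_sub_grtorsion.
rewrite addnS -addSn => tk Pv tv.
have lt_tr : (t < r)%N by rewrite -tk leq_addr.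
have tv' : torsion m (addm (IM t.+1) (P n.+2)) setT v.
  by move: v tv {Pv}; apply: torsionS => //; apply: addmS => //; apply:
    seqmulT_leq.
have [i IMi [j Tj vE]] := IHk t.+1 v tk Pv tv'.
have Etj : E t n.+1 j by apply: sub_addmr.
have iE : i = v - j by rewrite vE addrK.
have [i' Di' [_ [p Pp <-] iE']] : D t.+1 (P n) i.
  apply: seqmul_cap_pow => //; rewrite iE; apply: submodB => //.
  case: Tj => a Ta [b Pb ->]; apply: submodD => //; last exact: seqpow_leq Pb.
  by apply: seqpowS Ta => //; apply: submodT.
have IMi' : IM t i' by apply: seqmulS Di' => //; apply: submodT.
rewrite vE iE'; apply: submodD => //; apply: submodD => //.
  exact: seqmul_sub_grtorsion.
apply: grtorsionM => //; apply: IHn => //; first exact: ltnW.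
apply: torsion_mul_dseq => //.
have -> : y t *:
  p = v - (j + i') by rewrite vE iE' opprD addrA addrK addrC addKr.
apply: submodB => //; apply: submodD => //; apply: grtorsion_torsion => //.
exact: seqmul_sub_grtorsion.
Qed.

Lemma torsion_gr s n : (s <= r)%N ->
  torsion m (addm (IM s) (P n.+1)) (addm (IM s) (P n)) = E s n.
Proof.
move=> le_sr; apply/seteqP; split=> v; last first.
  move=> Ev; split; first exact: grtorsion_sub.
  by have [] := grtorsion_torsion Ev.
move=> [[i IMi [p Pp vE]] tv]; rewrite vE; apply: submodD => //.
  exact: seqmul_sub_grtorsion.
apply: torsion_grtorsion => //; have -> : p = v - i by rewrite vE addrC addKr.
apply: submodB => //; apply: sub_torsion => //.
exact: sub_addml.
Qed.

(** * Lengths of the torsion of the associated graded modules *)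

Hypothesis noethR : noetherian R.
Hypothesis finM : finitely_generated [set: M].

Let add_len := length_add_torsion localR noethR finM.

(** The length of the torsion of the degree n part of gr_I(M / I_s M). *)
Definition grlen s n := length (addm (IM s) (P n.+1)) (E s n).
Definition h0quo s := h0 m (IM s).

Lemma grlen0 s : (s <= r)%N -> grlen s 0 = h0quo r.
Proof.
move=> le_sr; rewrite /grlen grtorsion0 //; congr length.
apply/seteqP; split; last exact: sub_addmr.
by apply: addm_sub => //; apply: seqmulT_leq.
Qed.

Lemma grlen_last n : grlen r n.+1 = 0%N.
Proof.
rewrite /grlen; have rE : addm (IM r) (P n.+2) = IM r.
  apply/seteqP; split; last exact: sub_addml.
  by apply: addm_sub => //; apply: (@seqpow_sub_seqmul n.+1).
have -> : E r n.+1 = IM r.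
  apply/seteqP; split; last exact: seqmul_sub_grtorsion.
  apply: addm_sub => //; apply: addm_sub => //.
    by apply: subset_trans (@seqpow_sub_seqmul n); apply: seqpowS => //;
      apply: submodT.
  exact: (@seqpow_sub_seqmul n.+1).
by rewrite rE; have [] := length_refl (sIM r).
Qed.

(** The part of the torsion of degree n + 1 that comes from degree n by
    multiplication by y_s. *)
Definition grmul s n : set M :=
  addm (addm (IM s) (P n.+2)) [set y s *: v | v in E s n].

Let sB s n : submodule (grmul s n).
Proof. by apply: addm_submod => //; apply: scale_submod. Qed.

Lemma grmul_sub s n : (s < r)%N -> grmul s n `<=` E s n.+1.
Proof.
move=> lt_sr; apply: addm_sub => //; first exact: sub_grtorsion.
by move=> _ [v Ev <-]; apply: grtorsionM.
Qed.

(** Exactness in the middle: torsion of degree n + 1 that vanishes over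
    M / I_(s+1) M is y_s times an element of degree n, which is torsion because
    torsion can be divided by y_s. *)
Lemma grtorsion_cap s n v : (s < r)%N -> E s n.+1 v ->
  addm (IM s.+1) (P n.+2) v -> grmul s n v.
Proof.
move=> lt_sr Ev [_ [i IMi [_ [w _ <-] ->]] [b Pb vE]].
have ysE : y s *: w = v - (i + b) by rewrite vE [i + _ + b]addrAC [_ + y s *:
  w]addrC addrK.
have Eib : addm (IM s) (P n.+2) (i + b) by apply: addmI.
have [|u Uu [p Pp wE]] := @mul_dseq_inj n s w lt_sr.
  rewrite ysE; apply: submodB => //; first exact: grtorsion_sub.
  by apply: addmS Eib => //; apply: seqpow_leq.
have Eu : addm (IM s) (P n.+2) (y s *: u) by apply: sub_addml.
have vE' : v = i + b + y s *: u + y s *: p.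
  by rewrite -addrA -scalerDr -wE ysE addrC subrK.
rewrite vE'; apply: addmI; first exact: submodD.
exists p => //; apply: torsion_grtorsion => //; first exact: ltnW.
apply: torsion_mul_dseq => //.
have -> : y s *: p = v - (i + b + y s *: u) by rewrite vE' addrC addKr.
apply: submodB => //; first exact: grtorsion_torsion.
by apply: sub_torsion => //; apply: submodD.
Qed.

(** The quotient of the torsion by the part coming from degree n is the torsion
    of the degree n + 1 part of gr_I(M / I_(s+1) M): [grtorsion_cap] gives
    injectivity, and both are images of I^(n+1) T. *)
Lemma length_grmul s n : (s < r)%N ->
  grlen s n.+1 =
    (length (addm (IM s) (P n.+2)) (grmul s n) + grlen s.+1 n.+1)%N.
Proof.
move=> lt_sr; rewrite /grlen (add_len (K := grmul s n)) //; last first.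
- exact: grtorsion_torsion.
- exact: grmul_sub.
- by apply: sub_addml; apply: scale_submod.
congr (_ + _)%N.
have IM1 : addm (IM s) (P n.+2) `<=` addm (IM s.+1) (P n.+2).
  by apply: addmS => //; apply: seqmulT_leq.
apply: (@length_iso _ _ _ idfun) => //.
- exact: grmul_sub.
- exact: sub_grtorsion.
- by move=> v; apply: addmS => //; apply: seqmulT_leq.
- move=> v Ev; split; first exact: grtorsion_cap.
  move: v {Ev}; apply: addm_sub => // _ [v Ev <-].
  by apply: sub_addml => //; apply: seqmulM => //; apply: submodT.
- move=> _ [i IMi [j Tj ->]]; exists j; first exact: sub_addmr.
  by rewrite /= addrK; apply: (sub_addml (sP n.+2)).
Qed.

Lemma length_grmul_image s n (L : set M) : (s < r)%N -> L `<=` E s n ->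
  (forall v, E s n v -> addm (IM s) (P n.+2) (y s *: v) <-> L v) ->
  length (addm (IM s) (P n.+2)) (grmul s n) = length L (E s n).
Proof.
move=> lt_sr LE LP; apply/esym.
apply: (@length_iso _ _ _ ( *:%R (y s) : {linear M -> M})) => //.
- by apply: sub_addml; apply: scale_submod.
- by move=> v Ev; apply: sub_addmr => //; exists v.
- by move=> _ [a La [_ [v Ev <-] ->]]; exists v; rewrite //= addrK.
Qed.

Lemma grlen_rec s n : (s < r)%N ->
  grlen s n.+2 = (grlen s n.+1 + grlen s.+1 n.+2)%N.
Proof.
move=> lt_sr;
  rewrite length_grmul // (@length_grmul_image _ _ (addm (IM s) (P n.+2))) //.
  exact: sub_grtorsion.
move=> v Ev; split; last first.
  move=> [i IMi [p Pp ->]]; rewrite scalerDr; apply: addmI; first exact: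
    submodZ.
  by apply: seqpowM => //; apply: submodT.
apply: mul_dseq_inj_pos => //.
have : addm (IM s) (P n.+1) v by apply: grtorsion_sub.
apply: addm_sub => //; last exact: seqpow_sub_seqmul.
exact/seqmulT_leq/ltnW.
Qed.

Lemma length_colon s : (s < r)%N -> length (IM s) (U s) = h0quo s.
Proof. by move=> lt_sr; rewrite /h0quo /h0 -colon_torsion. Qed.

(** U_s / I_s M embeds in M / I_t M, because U_s meets I M only in I_s M. *)
Lemma length_colon_add s t : (s < r)%N -> (s <= t)%N -> (t <= r)%N ->
  length (IM t) (addm (IM t) (U s)) = h0quo s.
Proof.
move=> lt_sr le_st le_tr; rewrite length_addm // -length_colon //.
congr length; apply/seteqP; split=> v.
  by move=> [IMv Uv]; apply: colon_dseq_cap => //; apply: seqmulT_leq IMv.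
by move=> IMv; split; [apply: seqmulT_leq IMv|apply: sub_colon_dseq].
Qed.

(** In degree 0 multiplication by y_s has a kernel, the image of U_s; it is
    isomorphic to the torsion of M / I_s M, which gives the correction term. *)
Lemma grlen1 s : (s < r)%N ->
  (grlen s 1 + h0quo s = h0quo r + grlen s.+1 1)%N.
Proof.
move=> lt_sr; have le_sr := ltnW lt_sr.
have UT : addm (IM r) (U s) `<=` T.
  apply: addm_sub => //; first exact: sub_torsion.
  by rewrite colon_torsion //; apply: torsionS => //; apply: seqmulT_leq.
rewrite length_grmul // (@length_grmul_image _ _ (addm (IM r) (U s)))
  ?grtorsion0 //.
  rewrite addnAC; congr (_ + _)%N; rewrite /h0quo /h0.
  rewrite [RHS](add_len (K := addm (IM r) (U s))) //; last first.
  - exact: sub_addml.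
  - exact: addm_submod.
  by rewrite length_colon_add // addnC.
move=> v Tv; split.
  move=> /(@mul_dseq_inj 1 s v lt_sr)[u Uu [p Pp ->]]; rewrite addrC.
  exact: addmI.
move=> [i IMi [u Uu ->]]; rewrite scalerDr addrC; apply: addmI => //.
by apply: (@seqpowM _ _ _ _ 1) => //; apply: submodT.
Qed.

(** U_s + y_s M = I_(s+1) M + U_s, and U_s is torsion modulo I_s M, so the
    torsion of M / (U_s + y_s M) is that of M / I_(s+1) M divided by the image
    of U_s, and this image is isomorphic to U_s / I_s M. *)
Lemma h0quoS s : (s < r)%N ->
  (h0 m (addm (U s) [set y s *: v | v in [set: M]]) + h0quo s = h0quo s.+1)%N.
Proof.
move=> lt_sr; have IM1 := seqmulT_leq (leqnSn s).
have syM : submodule [set y s *: v | v in [set: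
  M]] by apply/scale_submod/submodT.
have KE : addm (U s) [set y s *: v | v in [set: M]] = addm (IM s.+1) (U s).
  apply/seteqP; split.
    apply: addm_sub; first exact: addm_submod.
      exact: sub_addmr.
    by move=> _ [v _ <-]; apply: sub_addml => //; apply: seqmulM => //; apply:
      submodT.
  apply: addm_sub; first exact: addm_submod.
    by apply: addmS => //; apply: sub_colon_dseq.
  exact: sub_addml.
have sK : submodule (addm (IM s.+1) (U s)) by apply: addm_submod.
have sN : submodule (torsion m (IM s.+1) setT).
  by apply: torsion_submod => //; apply: submodT.
have [l lU] := colon_pow lt_sr.
have KT : torsion m (addm (IM s.+1) (U s)) setT = torsion m (IM s.+1) setT.
  apply/seteqP; split; last by apply: torsionS => //; apply: sub_addml.
  apply: (@torsion_trans l) => // a _ ma [i IMi [u Uu ->]]; rewrite scalerDr.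
  by apply: submodD => //; [apply: submodZ|apply/IM1/lU].
rewrite {1}/h0 KE KT /h0quo [RHS](add_len (K := addm (IM s.+1) (U s))) //.
- by rewrite length_colon_add // addnC.
- exact: sub_addml.
- by rewrite -KT; apply: sub_torsion.
Qed.

End DSequence.

(** * The Koszul complex of a d-sequence *)

Section Koszul.
Variables (R : comNzRingType) (M : lmodType R) (r : nat) (x : 'I_r -> R).
Implicit Types (f g z w : {ffun {set 'I_r} -> M}) (S : {set 'I_r}).
Implicit Types (p q s : nat).

Local Notation d := (koszul_diff x).

Definition koszul_adm s p S := (#|S| == p) && [forall k in S, (k < s)%N].

(** The degree p part of the Koszul complex of the first s elements, as a
    subcomplex of the whole Koszul complex. *)
Definition koszul_sub s p : set {ffun {set 'I_r} -> M} :=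
  [set f | forall S, ~~ koszul_adm s p S -> f S = 0].
Local Notation K := koszul_sub.

(** Multiplication by e_s on the right; no sign appears because it is applied
    to elements that only involve the e_k with k < s. *)
Definition wedge (s : 'I_r) f : {ffun {set 'I_r} -> M} :=
  [ffun S : {set 'I_r} => if s \in S then f (S :\ s)%SET else 0].

Let addE f g S : (f + g) S = f S + g S. Proof. by rewrite ffunE. Qed.
Let scaleE a f S : (a *: f) S = a *: f S. Proof. by rewrite ffunE. Qed.

Lemma koszul_admP s p S :
  reflect (#|S| = p /\ forall k : 'I_r, k \in S -> (k < s)%N)
          (koszul_adm s p S).
Proof. by apply: (iffP andP) => -[/eqP Sp /forall_inP Ss]; split. Qed.

Lemma koszul_sub_submod s p : submodule (K s p).
Proof.
apply/submoduleP; split=> [S _|a f g Kf Kg S nS]; first by rewrite ffunE.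
by rewrite !ffunE Kf // Kg // scaler0 addr0.
Qed.

Let KD s p f g : K s p f -> K s p g -> K s p (f + g).
Proof. exact: (submodD (@koszul_sub_submod s p)). Qed.

Let KZ s p a f : K s p f -> K s p (a *: f).
Proof. exact: (submodZ _ (@koszul_sub_submod s p)). Qed.

Let K0 s p : K s p 0.
Proof. exact: (submod0 (@koszul_sub_submod s p)). Qed.

Lemma koszul_diff_linear a f g : d (a *: f + g) = a *: d f + d g.
Proof.
apply/ffunP => S; rewrite !ffunE scaler_sumr -big_split /=.
apply: eq_bigr => j _; rewrite !ffunE scalerDr; congr (_ + _).
by rewrite !scalerA mulrC.
Qed.

Lemma koszul_diffD f g : d (f + g) = d f + d g.
Proof. by rewrite -[f]scale1r koszul_diff_linear !scale1r. Qed.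

Lemma koszul_diff0 : d 0 = 0 :> {ffun {set 'I_r} -> M}.
Proof. by apply/(addIr (d 0)); rewrite -koszul_diffD !add0r. Qed.

Lemma koszul_diffZ a f : d (a *: f) = a *: d f.
Proof. by rewrite -[a *: f]addr0 koszul_diff_linear koszul_diff0 addr0. Qed.

Lemma koszul_sub0 (s : 'I_r) p f S : K s p f -> s \in S -> f S = 0.
Proof.
move=> Kf sS; apply: Kf; apply/negP => /koszul_admP[_ /(_ s sS)].
by rewrite ltnn.
Qed.

Lemma koszul_subS s p f : K s p f -> K s.+1 p f.
Proof.
move=> Kf S nS; apply: Kf; apply: contra nS => /koszul_admP[Sp Ss].
by apply/koszul_admP; split=> // k /Ss/ltnW.
Qed.

Lemma koszul_diff_sub s p f : K s p.+1 f -> K s p (d f).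
Proof.
move=> Kf S nS; rewrite ffunE big1 // => j jS; rewrite Kf ?scaler0 //.
apply: contra nS => /koszul_admP[]; rewrite cardsU1 jS => -[Sp] Ss.
by apply/koszul_admP; split=> // k kS; apply: Ss; rewrite in_setU1 kS orbT.
Qed.

Lemma koszul_diff_deg0 s f : K s 0 f -> d f = 0.
Proof.
move=> Kf; apply/ffunP => S; rewrite !ffunE big1 // => j jS.
by rewrite Kf ?scaler0 //; apply/negP => /koszul_admP[]; rewrite cardsU1 jS.
Qed.

Lemma koszul_diff_sub0 (s : 'I_r) p f S : K s p f -> s \in S -> d f S = 0.
Proof.
move=> Kf sS; rewrite ffunE big1 // => j _.
by rewrite (koszul_sub0 Kf) ?scaler0 // in_setU1 sS orbT.
Qed.

Lemma wedge_sub (s : 'I_r) p f : K s p f -> K s.+1 p.+1 (wedge s f).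
Proof.
move=> Kf S nS; rewrite ffunE; case: ifP => // sS; apply: Kf.
apply: contra nS => /koszul_admP[Sp Ss]; apply/koszul_admP; split.
  by rewrite (cardsD1 s) sS Sp.
move=> k kS; have [->//|ks] := eqVneq k s.
by apply/leqW/Ss; rewrite in_setD1 ks.
Qed.

Lemma wedge0 (s : 'I_r) : wedge s 0 = 0 :> {ffun {set 'I_r} -> M}.
Proof. by apply/ffunP => S; rewrite !ffunE; case: ifP. Qed.

Lemma wedge_inj (s : 'I_r) f g :
  (forall S, s \in S -> f S = 0) -> (forall S, s \in S -> g S = 0) ->
  f + wedge s g = 0 -> f = 0 /\ g = 0.
Proof.
move=> f0 g0 fg; have fgS S : f S + wedge s g S = 0.
  by have /ffunP/(_ S) := fg; rewrite !ffunE.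
split; apply/ffunP => S; rewrite [RHS]ffunE; have [sS|sS] := boolP (s \in S).
- exact: f0.
- by have := fgS S; rewrite ffunE (negbTE sS) addr0.
- exact: g0.
- have := fgS (s |: S)%SET;
  rewrite f0 ?finset.setU11 // add0r ffunE finset.setU11.
  by rewrite finset.setU1K.
Qed.

(** The last clause records that the coefficients of the two parts are
    coefficients of f, so that they lie in I M when those of f do. *)
Lemma koszul_sub_split (s : 'I_r) p f : K s.+1 p.+1 f ->
  exists f' f'', [/\ K s p.+1 f', K s p f'', f = f' + wedge s f'' &
    forall S, (f' S = 0 \/ f' S = f S) /\
              (f'' S = 0 \/ f'' S = f (s |: S)%SET)].
Proof.
move=> Kf; exists [ffun S : {set 'I_r} => if s \in S then 0 else f S].
exists [ffun S : {set 'I_r} => if s \in S then 0 else f (s |: S)%SET]; split.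
- move=> S nS; rewrite ffunE; case: ifPn => // sS; apply: Kf.
  apply: contra nS => /koszul_admP[Sp Ss]; apply/koszul_admP; split=> // k kS.
  rewrite ltn_neqAle -ltnS Ss // andbT.
  by apply: contraNneq sS => /ord_inj <-.
- move=> S nS; rewrite ffunE; case: ifPn => // sS; apply: Kf.
  apply: contra nS => /koszul_admP[]; rewrite cardsU1 sS => -[Sp] Ss.
  apply/koszul_admP; split=> // k kS.
  rewrite ltn_neqAle -ltnS Ss ?in_setU1 ?kS ?orbT // andbT.
  by apply: contraNneq sS => /ord_inj <-.
- apply/ffunP => S; rewrite !ffunE; case: ifPn => sS; last by rewrite addr0.
  by rewrite finset.setD11 finset.setD1K // add0r.
- by move=> S; rewrite !ffunE; case: ifP => _; split; auto.
Qed.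

(** The Koszul complex of s + 1 elements as the mapping cone of x_s on the one
    of the first s: this reduces all that follows to inductions on s in which
    signs of subsets no longer occur. *)
Lemma koszul_diff_wedge (s : 'I_r) p f : K s p f ->
  d (wedge s f) = wedge s (d f) + ((-1) ^+ p * x s) *: f.
Proof.
move=> Kf; apply/ffunP => S; rewrite !ffunE; have [sS|sS] := boolP (s \in S).
  rewrite (koszul_sub0 Kf sS) scaler0 addr0 [RHS](bigD1 s) ?finset.setD11 //=.
  rewrite (koszul_sub0 Kf) ?finset.setU11 // scaler0 add0r.
  apply: eq_big => [j|j jS].
    rewrite in_setD1 negb_and negbK; have [->|] := eqVneq j s => //=.
      by rewrite sS.
    by rewrite andbT.
  have js : j != s by apply: contraNneq jS => ->.
  rewrite ffunE in_setU1 sS orbT.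
  have -> : ((j |: S) :\ s = j |: (S :\ s))%SET.
    apply/setP => k; rewrite !inE; have [->|] := eqVneq k j => //=.
    by rewrite js.
  have [lt_js|le_sj] := ltnP j s.
    congr ((_ ^+ _ * _) *: _); apply: eq_card => k; rewrite !inE.
    have [->|] := eqVneq k s => //=.
    by rewrite ltnNge ltnW // andbF.
  rewrite Kf ?scaler0 //; apply/negP => /koszul_admP[_ /(_ j)].
  by rewrite finset.setU11 ltnNge le_sj => /(_ isT).
rewrite add0r (bigD1 s) //= ffunE finset.setU11 finset.setU1K // big1 ?addr0;
  last first.
  move=> j /andP[_ js];
    rewrite ffunE in_setU1 (negbTE sS) orbF eq_sym (negbTE js).
  by rewrite scaler0.
have [/koszul_admP[Sp Ss]|nS] := boolP (koszul_adm s p S); last first.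
  by rewrite Kf // !scaler0.
congr ((_ ^+ _ * _) *: _); rewrite -Sp; apply: eq_card => k; rewrite !inE.
by case: (boolP (k \in S)) => //= /Ss ->.
Qed.

Lemma koszul_sub_nil p f : K 0 p.+1 f -> f = 0.
Proof.
move=> Kf; apply/ffunP => S; rewrite ffunE Kf //;
  apply/negP => /koszul_admP[Sp Ss].
have /card_gt0P[k kS] : (0 < #|S|)%N by rewrite Sp.
by have := Ss k kS.
Qed.

Lemma koszul_diff_diff s p f : (s <= r)%N -> K s p f -> d (d f) = 0.
Proof.
elim: s p f => [|s IHs] [|p] f le_sr Kf.
- by rewrite (koszul_diff_deg0 Kf) koszul_diff0.
- by rewrite (koszul_sub_nil Kf) !koszul_diff0.
- by rewrite (koszul_diff_deg0 Kf) koszul_diff0.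
pose os := Ordinal le_sr.
have [f' [f'' [Kf' Kf'' -> _]]] := @koszul_sub_split os p f Kf.
rewrite !koszul_diffD (koszul_diff_wedge Kf'') !koszul_diffD koszul_diffZ.
rewrite (IHs _ _ (ltnW le_sr) Kf') add0r.
case: p Kf'' {Kf Kf'} => [|p] Kf''.
  by rewrite (koszul_diff_deg0 Kf'') wedge0 koszul_diff0 scaler0 addr0.
rewrite (koszul_diff_wedge (koszul_diff_sub Kf'')) (IHs _ _ (ltnW le_sr) Kf'').
by rewrite wedge0 add0r -scalerDl exprS mulN1r mulNr subrr scale0r.
Qed.

Definition koszul_const (v : M) : {ffun {set 'I_r} -> M} :=
  [ffun S : {set 'I_r} => if #|S| == 0%N then v else 0].

Lemma koszul_const_sub s v : K s 0 (koszul_const v).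
Proof.
move=> S nS; rewrite ffunE; case: ifPn => // S0; case/negP: nS.
apply/koszul_admP; rewrite (eqP S0); split=> // k kS.
by move: S0; rewrite cards_eq0 => /eqP SE; rewrite SE inE in kS.
Qed.

Lemma koszul_constE s f : K s 0 f -> f = koszul_const (f finset.set0).
Proof.
move=> Kf; apply/ffunP => S; rewrite ffunE; case: ifPn => [|S0].
  by rewrite cards_eq0 => /eqP->.
by apply: Kf; apply: contra S0 => /koszul_admP[->].
Qed.

Variable y : nat -> R.
Hypothesis yE : forall i : 'I_r, y i = x i.
Local Notation D := (seqmul y).
Local Notation IM s := (seqmul y s [set: M]).
Local Notation U s := (colon (IM s) (y s)).

Let sIM s : submodule (IM s). Proof. exact/seqmul_submod/submodT. Qed.

Lemma koszul_const_boundary s v : (s <= r)%N -> IM s v ->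
  exists2 f, K s 1 f & d f = koszul_const v.
Proof.
elim: s v => [|s IHs] v le_sr.
  move=> ->; exists 0 => //.
  by rewrite koszul_diff0; apply/ffunP => S; rewrite !ffunE if_same.
move=> [u IMu [_ [w _ <-] ->]]; pose os := Ordinal le_sr.
have [f Kf df] := IHs u (ltnW le_sr) IMu.
have Kw := @koszul_const_sub s w.
exists (f + wedge os (koszul_const w)).
  by apply: KD; [apply: koszul_subS|exact: (wedge_sub (s := os))].
rewrite koszul_diffD df (koszul_diff_wedge (s := os) Kw) (koszul_diff_deg0 Kw).
rewrite wedge0 add0r expr0 mul1r -yE /=.
apply/ffunP => S; rewrite !ffunE; case: ifP => // _.
by rewrite scaler0 addr0.
Qed.

Lemma koszul_diff_const s f : K s 1 f -> IM s (d f finset.set0).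
Proof.
move=> Kf; rewrite ffunE; apply: submod_sum => // j _.
have [lt_js|le_sj] := ltnP j s.
  by rewrite -scalerA -yE; apply: submodZ => //; apply: seqmulM => //; apply:
    submodT.
rewrite Kf ?scaler0; first exact: submod0.
apply/negP => /koszul_admP[_ /(_ j)].
by rewrite finset.setU11 ltnNge le_sj => /(_ isT).
Qed.

Hypothesis colon_cap : forall s v, (s < r)%N -> U s v -> IM r v -> IM s v.

(** For a d-sequence, cycles of positive degree with coefficients in I M are
    boundaries, already over each initial segment. Writing a cycle as
    z' + e_s z'', the coefficient z'' is a cycle of smaller degree, hence a
    boundary d u (in degree 0 this is [colon_cap]), and adding d (e_s u)
    reduces to a cycle over a shorter segment. *)
Lemma koszul_cycle_boundary s p z : (s <= r)%N -> K s p.+1 z -> d z = 0 ->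
  (forall S, IM r (z S)) -> exists2 w, K s p.+2 w & d w = z.
Proof.
elim: s p z => [|s IHs] p z le_sr Kz dz IMz.
  by exists 0; [|rewrite koszul_diff0 (koszul_sub_nil Kz)].
pose os := Ordinal le_sr; have lt_sr := ltnW le_sr.
have [z' [z'' [Kz' Kz'' zE zS]]] := @koszul_sub_split os p z Kz.
have IMz' S : IM r (z' S).
  by have [[->|->] _] := zS S; [apply: submod0|apply: IMz].
have IMz'' S : IM r (z'' S).
  by have [_ [->|->]] := zS S; [apply: submod0|apply: IMz].
have [dz' dz''] : d z' + ((-1) ^+ p * x os) *: z'' = 0 /\ d z'' = 0.
  apply: (@wedge_inj os) => [S sS|S sS|].
  - by rewrite addE scaleE (koszul_diff_sub0 Kz') // (koszul_sub0 Kz'') //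
      scaler0 addr0.
  - exact: koszul_diff_sub0 Kz'' sS.
  - by rewrite -dz zE koszul_diffD (koszul_diff_wedge Kz'') addrAC addrA.
have [u Ku du] : exists2 u, K s p.+1 u & d u = z''.
  case: p Kz Kz' Kz'' zE dz' {zS} => [|p] Kz Kz' Kz'' zE dz'; last exact: IHs.
  rewrite (koszul_constE Kz''); apply: koszul_const_boundary => //.
  apply: colon_cap => //; rewrite /colon /= (yE os).
  have /ffunP/(_ finset.set0) := dz'.
  rewrite expr0 mul1r addE scaleE [RHS]ffunE => /eqP.
  rewrite addrC addr_eq0 => /eqP->; apply: submodN => //.
  exact: koszul_diff_const.
have [||S|w Kw dw] := IHs p (z' + ((-1) ^+ p * x os) *: u) lt_sr.
- by apply: KD; [|apply: KZ].
- by rewrite koszul_diffD koszul_diffZ du.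
- rewrite addE scaleE -scalerA; apply: submodD => //; apply: submodZ => //.
  by rewrite -(yE os); apply: seqmulM => //; apply: submodT.
exists (w + wedge os u).
  by apply: KD; [apply: koszul_subS|exact: (wedge_sub (s := os))].
rewrite koszul_diffD (koszul_diff_wedge (s := os) Ku) dw du zE addrACA.
by rewrite exprS mulN1r mulNr scaleNr subrr addr0.
Qed.

Definition tail_set i s : {set 'I_r} := [set k :
  'I_r | (i <= k)%N && (k < s)%N]%SET.

(** Every v in U_i is the coefficient of e_i ... e_(r-1) in a cycle, built by
    adjoining one basis vector at a time: x_s kills the homology in positive
    degree of the Koszul complex of the first s elements, by
    [koszul_cycle_boundary]. *)
Lemma colon_cycle i q v : U i v -> (i + q <= r)%N ->
  exists z, [/\ K (i + q) q z, d z = 0 & z (tail_set i (i + q)) = v].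
Proof.
move=> Uv; elim: q => [|q IHq] le_r.
  exists (koszul_const v); split; first exact: koszul_const_sub.
    exact: koszul_diff_deg0 (@koszul_const_sub 0 v).
  have -> : tail_set i (i + 0) = finset.set0.
    by apply/setP => k; rewrite !inE addn0 ltnNge andbN.
  by rewrite ffunE cards0.
rewrite addnS in le_r *; pose os := Ordinal le_r;
  set s := (i + q)%N in le_r os *.
have [z [Kz dz zv]] := IHq (ltnW le_r).
have [w Kw dw] : exists2 w, K s q.+1 w & d w = - ((-1) ^+ q * x os) *: z.
  case: q @s le_r @os z Kz dz zv {IHq} => [|q] s le_r os z Kz dz zv.
    rewrite -(yE os) expr0 mul1r /=.
    have [|w Kw dw] := koszul_const_boundary (s := s) (v := - (y s *:
      v)) (ltnW le_r).
      by apply: submodN => //; rewrite /s addn0.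
    exists w => //; rewrite dw.
    have zE : z = koszul_const v.
      have Kz0 : K s 0 z by [].
      rewrite (koszul_constE Kz0) -zv; congr (koszul_const (z _)).
      by apply/setP => k; rewrite !inE addn0; case: ltnP.
    rewrite zE; apply/ffunP => S; rewrite !ffunE scaleNr.
    by case: ifP => // _; rewrite scaler0 oppr0.
  apply: koszul_cycle_boundary => //; first exact: ltnW.
  - exact: KZ.
  - by rewrite koszul_diffZ dz scaler0.
  - move=> S; rewrite scaleE -mulNr -scalerA; apply: submodZ => //.
    by rewrite -(yE os); apply: seqmulM => //; apply: submodT.
exists (wedge os z + w); split.
- by apply: KD; [exact: (wedge_sub (s := os))|apply: koszul_subS].
- by rewrite koszul_diffD (koszul_diff_wedge (s := os) Kz) dz dw wedge0 add0r
    scaleNr subrr.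
- have sA : os \in tail_set i s.+1 by rewrite inE /= leq_addr leqnn.
  rewrite addE ffunE sA (koszul_sub0 (s := os) Kw sA) addr0 -[RHS]zv;
    congr (z _).
  apply/setP => k; rewrite !inE ltnS [(k <= s)%N]leq_eqVlt -(inj_eq val_inj) /=.
  by case: ltngtP; rewrite ?andbT ?andbF // => ->.
Qed.

Variable m : set R.
Hypothesis localR : local_ring m.

(** Amenability enters here: the coefficient of e_i ... e_(r-1) maps boundaries
    into I_i M, so that a power of m which kills the homology in degree r - i
    kills U_i modulo I_i M by [colon_cycle]. *)
Lemma amenable_colon_pow i : amenable M x -> (i < r)%N ->
  exists k, forall a v, ideal_pow m k a -> U i v -> IM i (a *: v).
Proof.
move=> amen lt_ir; pose p := (r - i)%N.
have irE : (i + p)%N = r by rewrite subnKC // ltnW.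
have degE q f : koszul_deg M r q f <-> K r q f.
  split=> Kf S nS; apply: Kf.
    by apply: contra nS => Sq; apply/koszul_admP; split=> //; apply/eqP.
  by apply: contra nS => /koszul_admP[->].
have sB : submodule (koszul_boundary M x p).
  apply/submoduleP; split.
    by exists 0; [apply/degE|rewrite koszul_diff0].
  move=> a _ _ [f /degE Kf <-] [g /degE Kg <-]; exists (a *: f + g).
    by apply/degE/KD => //; apply: KZ.
  by rewrite koszul_diff_linear.
have sZ : submodule (koszul_cycle M x p).
  apply/submoduleP; split.
    by split; [apply/degE|rewrite koszul_diff0].
  move=> a f g [/degE Kf df] [/degE Kg dg]; split.
    by apply/degE/KD => //; apply: KZ.
  by rewrite koszul_diff_linear df dg scaler0 addr0.
have BZ : koszul_boundary M x p `<=` koszul_cycle M x p.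
  move=> _ [f /degE Kf <-]; split; first exact/degE/koszul_diff_sub.
  exact: koszul_diff_diff (leqnn r) Kf.
have p_gt0 : (0 < p)%N by rewrite subn_gt0.
have [k kP] := finite_length_pow localR sB sZ BZ (amen p p_gt0).
exists k => a v ma Uv.
have [|z [Kz dz zv]] := @colon_cycle i p v Uv; first by rewrite irE.
rewrite irE in Kz zv.
have [|f _ dfz] := kP a z ma; first by split=> //; apply/degE.
rewrite -zv -scaleE -dfz ffunE; apply: submod_sum => // j.
rewrite inE ltn_ord andbT -ltnNge => lt_ji.
by rewrite -scalerA -yE; apply: submodZ => //; apply: seqmulM => //; apply:
  submodT.
Qed.

End Koszul.

(** * Binomial sums *)

(** The partial sums S_s(n) of g_s satisfy S_s(0) = u_r and
    S_s(n+1) + u_s = S_s(n) + S_(s+1)(n+1), which also hold for the right-hand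
    side: the former because the kappas telescope, the latter by Pascal's
    rule. *)
Lemma binomial_recursion (r : nat) (g : nat -> nat -> nat)
    (u kappa : nat -> nat) :
  (forall s, (s <= r)%N -> g s 0%N = u r) ->
  (forall n, g r n.+1 = 0%N) ->
  (forall s, (s < r)%N -> (g s 1 + u s = u r + g s.+1 1)%N) ->
  (forall s n, (s < r)%N -> g s n.+2 = (g s n.+1 + g s.+1 n.+2)%N) ->
  (forall s, (s < r)%N -> (kappa s + u s = u s.+1)%N) ->
  forall q s n, (s + q = r)%N ->
  (\sum_(k < n.+1) g s k =
     u s + \sum_(j < q) kappa (s + j) * 'C(n + j.+1, j.+1))%N.
Proof.
move=> g0 gr g1 gS kappaS.
have ksum q s : (s + q = r)%N -> (u s + \sum_(j < q) kappa (s + j) = u r)%N.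
  elim: q s => [|q IHq] s sq; first by rewrite big_ord0 -sq !addn0.
  rewrite big_ord_recl addn0 addnA [(u s + _)%N]addnC kappaS; last first.
    by rewrite -sq addnS ltnS leq_addr.
  rewrite -(IHq s.+1); last by rewrite addSnnS.
  by congr (_ + _)%N; apply: eq_bigr => j _; rewrite addSnnS.
have Srec s n : (s < r)%N -> (\sum_(k < n.+2) g s k + u s =
    \sum_(k < n.+1) g s k + \sum_(k < n.+2) g s.+1 k)%N.
  move=> lt_sr; elim: n => [|n IHn].
    rewrite !(big_ord_recr, big_ord0) /= !add0n -addnA g1 // !g0 //.
    exact: ltnW.
  rewrite big_ord_recr /= addnAC IHn gS // addnACA.
  by rewrite [X in _ = (X + _)%N]big_ord_recr [X in _ = (_ + X)%N]big_ord_recr.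
elim=> [|q IHq] s n sq.
  rewrite addn0 in sq; rewrite big_ord0 addn0 sq big_ord_recl g0 //.
  by rewrite big1 ?addn0 // => k _; rewrite gr.
have lt_sr : (s < r)%N by rewrite -sq addnS ltnS leq_addr.
elim: n => [|n IHn].
  rewrite big_ord_recl big_ord0 addn0 (g0 s (ltnW lt_sr)) -(ksum q.+1 s sq).
  by congr (_ + _)%N; apply: eq_bigr => j _; rewrite add0n binn muln1.
apply/eqP; rewrite -(eqn_add2r (u s)) Srec // IHn IHq ?addSnnS // -kappaS //.
rewrite [(kappa s + _)%N]addnC -!addnA eqn_add2l; apply/eqP.
rewrite addnCA [RHS]addnC; congr (_ + _)%N.
have -> : (kappa s + \sum_(j < q) kappa (s.+1 + j) * 'C(n.+1 + j.+1, j.+1) =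
    \sum_(j < q.+1) kappa (s + j) * 'C(n.+1 + j, j))%N.
  rewrite big_ord_recl addn0 bin0 muln1; congr (_ + _)%N.
  by apply: eq_bigr => j _; rewrite addSnnS.
rewrite -big_split /=; apply: eq_bigr => j _; rewrite -mulnDr.
by rewrite [in RHS]addSn binS addSnnS.
Qed.

(** The binomial polynomials of distinct degrees are independent, even as
    germs at infinity: taking differences lowers all degrees by one. *)
Lemma binomial_sum_eq0 (r n0 : nat) (e : nat -> int) :
  (forall n, (n0 <= n)%N ->
     \sum_(i < r.+1) e i * ('C(n + r - i, r - i))%:Z = 0) ->
  forall i, (i <= r)%N -> e i = 0.
Proof.
elim: r n0 e => [|r IHr] n0 e eq0.
  move=> i; rewrite leqn0 => /eqP->; have := eq0 n0 (leqnn n0).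
  by rewrite big_ord_recl big_ord0 addr0 addn0 !subn0 bin0 mulr1.
have lee i : (i <= r)%N -> e i = 0.
  apply: (IHr n0.+1) => -[//|n] le_n.
  rewrite -[RHS](subrr 0) -[X in X - _](eq0 n.+1 (leqW le_n)).
  rewrite -[X in _ - X](eq0 n le_n) -sumrB [RHS]big_ord_recr /=.
  rewrite subnn !bin0 subrr addr0; apply: eq_bigr => j _ /=.
  have le_jr : (j <= r)%N by rewrite -ltnS.
  rewrite -mulrBr; congr (_ * _); rewrite (subSn le_jr).
  rewrite -!addnBA ?(leqW le_jr) // (subSn le_jr).
  by rewrite [in RHS]addSn binS PoszD addrAC subrr add0r addSnnS.
move=> i; rewrite leq_eqVlt => /orP[/eqP->|]; last exact: lee.
have := eq0 n0 (leqnn n0); rewrite big_ord_recr big1 /= => [|j _].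
  by rewrite add0r subnn bin0 mulr1.
by rewrite lee ?mul0r // -ltnS.
Qed.

(** * Products of ideals and submodules *)

Lemma add0m (R : comNzRingType) (M : lmodType R) (N : set M) :
  addm [set 0] N = N.
Proof.
apply/seteqP; split=> [_ [_ -> [v Nv ->]]|v Nv]; first by rewrite add0r.
by exists 0 => //; exists v; rewrite ?add0r.
Qed.

Section Bridge.
Variables (R : comNzRingType) (M : lmodType R).
Implicit Types (N : set M) (J K : set R).

Lemma mscaleA J K N :
  mscale (mscale (M := R^o) J K) N = mscale J (mscale K N).
Proof.
apply/seteqP; split; apply: mscale_sub; try exact: mscale_submod.
  move=> c v JKc Nv; move: c JKc.
  apply: (mscale_sub (scalars_submod v (mscale_submod J (mscale K N)))).
  by move=> a b Ja Kb; rewrite /= -scalerA; apply: mscaleM => //; apply: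
    mscaleM.
move=> a w Ja; move: w.
apply: mscale_sub; first exact: colon_submod (mscale_submod _ _).
move=> b v Kb Nv; rewrite /colon /= scalerA.
by apply: mscaleM => //; apply: (@mscaleM R R^o).
Qed.

Lemma mscaleT N : submodule N -> mscale setT N = N.
Proof.
move=> sN; apply/seteqP; split; first by apply: mscale_sub => // a v _; apply:
  submodZ.
by move=> v Nv; rewrite -[v]scale1r; apply: mscaleM.
Qed.

Lemma mscale_principal a N : submodule N ->
  mscale (ideal_span [set a]) N = [set a *: v | v in N].
Proof.
move=> sN; have saN := scale_submod a sN; apply/seteqP; split.
  apply: mscale_sub => // c v ac Nv; move: c ac.
  by apply: (span_sub (scalars_submod v saN)) => _ -> /=; exists v.
by move=> _ [v Nv <-]; apply: mscaleM => //; apply: (@subset_span R R^o).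
Qed.

Variables (r : nat) (x : 'I_r -> R) (y : nat -> R).
Hypothesis yE : forall i : 'I_r, y i = x i.

Lemma mscale_seq_ideal s N : submodule N -> (s <= r)%N ->
  mscale (seq_ideal x s) N = seqmul y s N.
Proof.
move=> sN le_sr; have sDN := seqmul_submod y s sN; apply/seteqP; split.
  apply: mscale_sub => // a v xa Nv; move: a xa.
  apply: (span_sub (scalars_submod v sDN)) => _ [k lt_ks <-] /=.
  by rewrite -yE; apply: seqmulM.
apply: seqmul_ind => [|k v lt_ks Nv]; first exact: mscale_submod.
apply: mscaleM => //; apply: (@subset_span R R^o).
by exists (Ordinal (leq_trans lt_ks le_sr)) => //; rewrite -yE.
Qed.

Lemma seq_submodE s : (s <= r)%N -> seq_submod M x s = seqmul y s setT.
Proof. by move=> le_sr; apply: mscale_seq_ideal => //; apply: submodT. Qed.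

Lemma pow_submodE n : pow_submod M (seq_ideal x r) n = seqpow y r n setT.
Proof.
elim: n => [|n IHn]; first by rewrite /pow_submod mscaleT //; apply: submodT.
have -> : pow_submod M (seq_ideal x r) n.+1 =
    mscale (seq_ideal x r) (pow_submod M (seq_ideal x r) n) by apply: mscaleA.
by rewrite IHn mscale_seq_ideal //; apply: seqpow_submod; apply: submodT.
Qed.

End Bridge.

(** * The j-function of an amenable d-sequence *)

Lemma j_coef_unique (r : nat) (c c' : {ffun 'I_r.+1 -> int}) (n0 : nat) :
  (forall n, (n0 <= n)%N -> j_poly c n = j_poly c' n) -> c = c'.
Proof.
move=> cc'; apply/ffunP => i; apply/eqP; rewrite -subr_eq0.
pose e j : int := (-1) ^+ j * (c (inord j) - c' (inord j)).
have : e i = 0.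
  apply: (@binomial_sum_eq0 r n0) => [n le_n|]; last by rewrite -ltnS.
  rewrite -[RHS](subrr (j_poly c n)) {2}cc' // /j_poly -sumrB.
  apply: eq_bigr => j _; rewrite /e inord_val mulrBr mulrBl.
  by [].
by rewrite /e inord_val => /eqP; rewrite mulf_eq0 signr_eq0.
Qed.

Theorem theorem4p7 (R : comNzRingType) (m : set R)
    (noethR : noetherian R) (localR : local_ring m)
    (M : lmodType R) (finM : finitely_generated [set: M])
    (d : nat) (dimM : module_dim [set 0 : M] d) (d_gt0 : (0 < d)%N)
    (r : nat) (r_le_d : (r <= d)%N) (x : 'I_r -> R)
    (sop_x : partial_sop M m x) (amen_x : amenable M x)
    (dseq_x : d_sequence M x) :
  (forall n : nat,
     j_function M m (seq_ideal x r) n =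
     (\sum_(i < r.+1) k_coef M m x i * 'C(n + r - i, r - i))%N) /\
  (forall i : 'I_r.+1, (-1) ^+ i * j_coef M m x i = (k_coef M m x i)%:Z).
Proof.
(* The sequence is extended by 0 to all natural indices. *)
pose y k : R := if insub k is Some i then x i else 0.
have yE (i : 'I_r) : y i = x i by rewrite /y valK.
pose IM s := seqmul y s [set: M].
have IME s : (s <= r)%N -> seq_submod M x s = IM s by apply: seq_submodE.
have ym s : (s < r)%N -> m (y s).
  by move=> lt_sr; rewrite -[s]/(val (Ordinal lt_sr)) yE; apply: sop_x.1.
have dseq i j v : (i <= j)%N -> (j < r)%N ->
    IM i ((y i * y j) *: v) -> IM i (y j *: v).
  move=> le_ij lt_jr; have lt_ir := leq_ltn_trans le_ij lt_jr.
  have := dseq_x (Ordinal lt_ir) (Ordinal lt_jr) le_ij.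
  rewrite IME ?(ltnW lt_ir) // -!yE /= => /seteqP[sub _].
  exact: sub.
have colon_pow s : (s < r)%N -> exists k, forall a v,
    ideal_pow m k a -> colon (IM s) (y s) v -> IM s (a *: v).
  apply: (amenable_colon_pow yE _ localR amen_x) => t v.
  exact: colon_dseq_cap.
pose g := grlen M y r m; pose u := h0quo M y m.
pose kappa s := h0 m (addm (colon (IM s) (y s)) [set y s *: v | v in [set: M]]).
have kE (i : 'I_r.+1) : k_coef M m x i =
    if (i < r)%N then kappa (r - i.+1)%N else u 0%N.
  rewrite /k_coef; case: unliftP => [i' ->|->]; last by rewrite ltnn.
  have lift_val : lift ord_max i' = i' :> nat by rewrite lift_max.
  rewrite lift_val ltn_ord /kappa /= IME ?leq_subr // -(yE (rev_ord i')) /=.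
  rewrite mscale_principal; last exact: submodT.
  rewrite msumE //.
    by apply: colon_submod; apply: seqmul_submod; apply: submodT.
  by apply: scale_submod; apply: submodT.
have jE n : j_function M m (seq_ideal x r) n = (\sum_(k < n.+1) g 0%N k)%N.
  apply: eq_bigr => k _; rewrite /g /grlen -(torsion_gr dseq colon_pow) //=.
  by rewrite !(pow_submodE M yE) !add0m.
have formula n : j_function M m (seq_ideal x r) n =
    (\sum_(i < r.+1) k_coef M m x i * 'C(n + r - i, r - i))%N.
  rewrite jE (@binomial_recursion r g u kappa _ _ _ _ _ r 0%N n (add0n r)).
  - rewrite [RHS]big_ord_recr /= kE ltnn subnn bin0 muln1 addnC;
    congr (_ + _)%N.
    rewrite [RHS](reindex_inj rev_ord_inj) /=; apply: eq_bigr => j _.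
    rewrite kE /= add0n ltn_subrL /= (leq_ltn_trans (leq0n j)) //.
    by rewrite -addnBA ?leq_subr // subKn // subnSK // subKn // ltnW.
  - by move=> s; apply: grlen0.
  - by move=> k; apply: grlen_last.
  - by move=> s; apply: grlen1.
  - by move=> s k; apply: grlen_rec.
  - by move=> s; apply: h0quoS.
split=> //.
pose c : {ffun 'I_r.+1 -> int} := [ffun i :
  'I_r.+1 => (-1) ^+ i * (k_coef M m x i)%:Z].
have cE n : (j_function M m (seq_ideal x r) n)%:Z = j_poly c n.
  rewrite formula /j_poly -[LHS]natz natr_sum; apply: eq_bigr => i _.
  by rewrite ffunE signrMK natrM !natz.
suff -> : j_coef M m x = c by move=> i; rewrite ffunE signrMK.
apply: xget_unique; first by exists 0%N.
move=> c' [n0 c'P]; apply: (@j_coef_unique _ _ _ n0) => n le_n.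
by rewrite -c'P // cE.
Qed.
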